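(* Let $C\subset\mathbf{P}^{n+1}$ be an arithmetically Buchsbaum, non arithmetically Cohen-Macaulay curve, and let $X\subset\mathbf{P}^n$ be its general hyperplane section. Let $M=(a_{ij})_{i=1,\ldots,t;\ j=1,\ldots,r}$, $a_{ij}=m_i-d_j$, be the lifting matrix of $X$, where $m_1\ge\cdots\ge m_t$ are the shifts of the last free module, and $d_1\geq\cdots\geq d_r$ those of the first free module, in the minimal free resolution of $I_X$. Then $$\alpha(\mathcal{M}_C)\ \ge\ \max\{\,m_t-n-1,\ \alpha(I_X)-1\,\}$$ and $$\alpha^+(\mathcal{M}_C)\ \le\ m_1-n-1.$$
   Context: $k$ is an algebraically closed field (of arbitrary characteristic). A curve in $\mathbf{P}^{n+1}$ is a non-degenerate, equidimensional, locally Cohen-Macaulay closed subscheme of dimension $1$. Its deficiency module is $\mathcal{M}_C=\bigoplus_{m\in\mathbf{Z}}H^1(\mathbf{P}^{n+1},\mathcal{I}_C(m))$, a graded module over $S=k[x_0,\ldots,x_{n+1}]$. $C$ is arithmetically Cohen-Macaulay if and only if $\mathcal{M}_C=0$; $C$ is arithmetically Buchsbaum if $\mathcal{M}_C$ is annihilated by $(x_0,\ldots,x_{n+1})$. The general hyperplane section of $C$ is $X=C\cap H\subset H\cong\mathbf{P}^n$ for a general hyperplane $H$. With $R=k[x_0,\ldots,x_n]$, the minimal graded free resolution of the saturated ideal $I_X\subset R$ is $0\to\bigoplus_{i=1}^{t}R(-m_i)\to\mathbf{F}_{n-1}\to\cdots\to\mathbf{F}_2\to\bigoplus_{j=1}^{r}R(-d_j)\to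 I_X\to 0$ (of length $n$), with $m_1\ge\cdots\ge m_t$, $d_1\ge\cdots\ge d_r$; the lifting matrix of $X$ is $(m_i-d_j)_{i,j}$. For a graded module $N$, $\alpha(N)=\min\{m\in\mathbf{Z}: N_m\neq 0\}$ is its initial degree, and if $N$ has finite length, $\alpha^+(N)=\max\{m\in\mathbf{Z}: N_m\ne 0\}$ is its final degree. *)

(* Defs.v *)
From HB Require Import structures.
From mathcomp Require Import all_boot all_order all_algebra.
From mathcomp Require Export fraction mpoly.
Set Implicit Arguments.
Unset Strict Implicit.
Unset Printing Implicit Defensive.

Import Order.TTheory GRing.Theory Num.Theory.
Local Open Scope ring_scope.

(* {mpoly k[N]} is the homogeneous coordinate ring of the projective space of
   dimension N - 1. Ideals are predicates. *)

(* Homogeneous of integer degree z; when z < 0 only f = 0 qualifies. *)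
Definition homogz (k : fieldType) (N : nat) (z : int) (f : {mpoly k[N]}) : Prop :=
  forall w, w \in msupp f -> (mdeg w)%:Z = z.

Definition ideal_pred (A : nzRingType) (J : A -> Prop) : Prop :=
  [/\ J 0, forall f g, J f -> J g -> J (f + g) & forall f g, J g -> J (f * g)].

Definition homog_ideal (k : fieldType) (N : nat) (J : {mpoly k[N]} -> Prop) : Prop :=
  ideal_pred J /\ forall f d, J f -> J (pihomog mdeg d f).

(* Saturation with respect to the irrelevant ideal (X_0, ..., X_(N-1)). *)
Definition saturation (k : fieldType) (N : nat) (J : {mpoly k[N]} -> Prop)
    (f : {mpoly k[N]}) : Prop :=
  exists e : nat, forall w : 'X_{1..N}, mdeg w = e -> J ('X_[w] * f).

(* A closed subscheme of projective space, given by its saturated homogeneous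
   ideal. *)
Record closed_subscheme (k : fieldType) (N : nat) := ClosedSubscheme {
  subscheme_ideal :> {mpoly k[N]} -> Prop;
  _ : homog_ideal subscheme_ideal;
  _ : forall f, saturation subscheme_ideal f -> subscheme_ideal f
}.

(* Points of the Proj scheme: homogeneous primes other than the irrelevant
   ideal. *)
Definition proj_point (k : fieldType) (N : nat) (P : {mpoly k[N]} -> Prop) : Prop :=
  [/\ homog_ideal P, ~ P 1, forall f g, P (f * g) -> P f \/ P g
    & exists i : 'I_N, ~ P 'X_i].

Definition ideal_sub (A : Type) (P Q : A -> Prop) : Prop := forall f, P f -> Q f.

Definition ideal_proper (A : Type) (P Q : A -> Prop) : Prop :=
  ideal_sub P Q /\ exists f, Q f /\ ~ P f.

Definition point_of (k : fieldType) (N : nat) (C : closed_subscheme k N)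
    (P : {mpoly k[N]} -> Prop) : Prop :=
  proj_point P /\ ideal_sub C P.

Definition has_chain (A : Type) (pts : (A -> Prop) -> Prop) (d : nat) : Prop :=
  exists c : nat -> A -> Prop,
    (forall i, (i <= d)%N -> pts (c i)) /\
    (forall i, (i < d)%N -> ideal_proper (c i) (c i.+1)).

(* Krull dimension of a family of primes; the second clause bounds all longer
   chains, since chains can be truncated. *)
Definition has_dim (A : Type) (pts : (A -> Prop) -> Prop) (d : nat) : Prop :=
  has_chain pts d /\ ~ has_chain pts d.+1.

(* Z is the generic point of an irreducible component of C. *)
Definition component (k : fieldType) (N : nat) (C : closed_subscheme k N)
    (Z : {mpoly k[N]} -> Prop) : Prop :=
  point_of C Z /\ forall Q, point_of C Q -> ideal_sub Q Z -> ideal_sub Z Q.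

Definition equidimensional (k : fieldType) (N : nat) (C : closed_subscheme k N)
    (d : nat) : Prop :=
  has_dim (point_of C) d /\
  forall Z, component C Z -> has_dim (fun P => point_of C P /\ ideal_sub Z P) d.

Definition ideal_adjoin (A : nzRingType) (J : A -> Prop) (s : seq A) (f : A) : Prop :=
  exists g (c : nat -> A), J g /\ f = g + \sum_(j < size s) c j * s`_j.

(* For homogeneous u, and v homogeneous of the same degree outside P: u / v lies
   in the extension of J to the local ring at P, the degree 0 part of the
   homogeneous localization. *)
Definition in_local (k : fieldType) (N : nat) (P J : {mpoly k[N]} -> Prop)
    (u : {mpoly k[N]}) : Prop :=
  exists v (d : nat), [/\ homogz d v, ~ P v & J (v * u)].

(* A regular sequence in the maximal ideal of the local ring of C at P. Up to
   units, an element of that local ring is its homogeneous numerator. *)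
Definition local_regular_seq (k : fieldType) (N : nat) (C : closed_subscheme k N)
    (P : {mpoly k[N]} -> Prop) (s : seq {mpoly k[N]}) : Prop :=
  forall i, (i < size s)%N ->
    [/\ exists d : nat, homogz d s`_i, P s`_i
      & forall u (d : nat), homogz d u ->
          in_local P (ideal_adjoin C (take i s)) (s`_i * u) ->
          in_local P (ideal_adjoin C (take i s)) u].

(* At every point there is a regular sequence of length the dimension of the
   local ring, that is, depth = dim. *)
Definition locally_CM (k : fieldType) (N : nat) (C : closed_subscheme k N) : Prop :=
  forall P, point_of C P ->
    exists s, has_dim (fun Q => point_of C Q /\ ideal_sub Q P) (size s) /\
              local_regular_seq C P s.

Definition nondegenerate (k : fieldType) (N : nat) (C : closed_subscheme k N) : Prop :=
  forall l, homogz 1 l -> C l -> l = 0.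

Definition is_curve (k : fieldType) (N : nat) (C : closed_subscheme k N) : Prop :=
  [/\ nondegenerate C, equidimensional C 1 & locally_CM C].

(* Sections over D_+('X_[w]) of the m-th twist of the ideal sheaf of C, as
   elements of the fraction field of the coordinate ring. *)
Definition ideal_section (k : fieldType) (N : nat) (C : closed_subscheme k N)
    (w : 'X_{1..N}) (m : int) (q : {fraction {mpoly k[N]}}) : Prop :=
  exists (e : nat) (f : {mpoly k[N]}),
    [/\ C f, homogz (m + (e * mdeg w)%N%:Z) f
      & q = tofrac f / tofrac ('X_[w] ^+ e)].

(* H^1(I_C(m)) is the first Cech cohomology group for the affine cover by the
   D_+(X_i). Cochains are indexed by all pairs (i, j); the cocycle condition
   makes them alternating. *)
Definition cocycle (k : fieldType) (N : nat) (C : closed_subscheme k N) (m : int)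
    (c : 'I_N -> 'I_N -> {fraction {mpoly k[N]}}) : Prop :=
  (forall i j, ideal_section C (U_(i) + U_(j))%MM m (c i j)) /\
  (forall i j l, c j l - c i l + c i j = 0).

Definition coboundary (k : fieldType) (N : nat) (C : closed_subscheme k N) (m : int)
    (c : 'I_N -> 'I_N -> {fraction {mpoly k[N]}}) : Prop :=
  exists b : 'I_N -> {fraction {mpoly k[N]}},
    (forall i, ideal_section C U_(i)%MM m (b i)) /\
    (forall i j, c i j = b j - b i).

(* The degree m component of the deficiency module of C is nonzero. *)
Definition deficiency_neq0 (k : fieldType) (N : nat) (C : closed_subscheme k N)
    (m : int) : Prop :=
  exists c, cocycle C m c /\ ~ coboundary C m c.

(* The deficiency module vanishes. *)
Definition arithmetically_CM (k : fieldType) (N : nat)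
    (C : closed_subscheme k N) : Prop :=
  forall m c, cocycle C m c -> coboundary C m c.

Definition arithmetically_Buchsbaum (k : fieldType) (N : nat)
    (C : closed_subscheme k N) : Prop :=
  forall (l : 'I_N) m c, cocycle C m c ->
    coboundary C (m + 1) (fun i j => tofrac 'X_l * c i j).

(* The columns of B identify the hyperplane of equation
   a_0 X_0 + ... + a_N X_N = 0 with a projective space of dimension one less. *)
Definition parametrizes (k : fieldType) (N : nat) (a : 'rV[k]_N.+1)
    (B : 'M[k]_(N.+1, N)) : Prop :=
  \rank B = N /\ a *m B = 0.

Definition restrict (k : fieldType) (N : nat) (B : 'M[k]_(N.+1, N))
    (f : {mpoly k[N.+1]}) : {mpoly k[N]} :=
  f \mPo [tuple \sum_(j < N) B i j *: 'X_j | i < N.+1].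

(* Saturated ideal of the section of C by the hyperplane parametrized by B. *)
Definition section_ideal (k : fieldType) (N : nat) (C : closed_subscheme k N.+1)
    (B : 'M[k]_(N.+1, N)) : {mpoly k[N]} -> Prop :=
  saturation (fun g => exists f, C f /\ g = restrict B f).

(* Q holds on a nonempty Zariski open subset of the dual projective space. *)
Definition general_hyperplane (k : fieldType) (N : nat) (Q : 'rV[k]_N -> Prop) : Prop :=
  exists (g : {mpoly k[N]}) (d : nat),
    [/\ g != 0, homogz d g
      & forall a : 'rV[k]_N, a != 0 -> g.@[fun i => a 0 i] != 0 -> Q a].

(* Minimal graded free resolution of J of length n: the modules F_1, ..., F_n are
   numbered from 0, the i-th one being the sum of the R(-z) for z in shifts i.
   Elements are row vectors, and matrices act on the right. *)
Record min_free_resolution (k : fieldType) (N : nat) (J : {mpoly k[N]} -> Prop)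
    (n : nat) := MinFreeResolution {
  shifts : nat -> seq int;
  augm : 'cV[{mpoly k[N]}]_(size (shifts 0));
  diff : forall i, 'M[{mpoly k[N]}]_(size (shifts i.+1), size (shifts i));
  _ : forall i, (n <= i)%N -> shifts i = [::];
  _ : forall p : 'I_(size (shifts 0)), homogz (shifts 0)`_p (augm p 0);
  _ : forall i (p : 'I_(size (shifts i.+1))) (q : 'I_(size (shifts i))),
        homogz ((shifts i.+1)`_p - (shifts i)`_q) (diff i p q);
  _ : forall f, J f <-> exists u : 'rV_(size (shifts 0)), f = (u *m augm) 0 0;
  _ : forall u : 'rV_(size (shifts 0)),
        u *m augm = 0 <-> exists v, u = v *m diff 0;
  _ : forall i (u : 'rV_(size (shifts i.+1))),
        u *m diff i = 0 <-> exists v, u = v *m diff i.+1;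
  (* minimality: the image of each differential lies in (X_0, ..., X_(N-1)) F *)
  _ : forall i p q, (diff i p q)@_0%MM = 0
}.

Definition lifting_matrix (m d : seq int) : 'M[int]_(size m, size d) :=
  \matrix_(i < size m, j < size d) (m`_i - d`_j).

Definition ideal_neq0 (k : fieldType) (N : nat) (J : {mpoly k[N]} -> Prop)
    (z : int) : Prop :=
  exists f, [/\ J f, homogz z f & f != 0].

(* supp is the set of degrees in which a graded module is nonzero. *)
Definition initial_degree (supp : int -> Prop) (a : int) : Prop :=
  supp a /\ forall z, supp z -> a <= z.

Definition final_degree (supp : int -> Prop) (a : int) : Prop :=
  supp a /\ forall z, supp z -> z <= a.

(* Main.v *)
(* Let I be the saturated ideal of C, l a general linear form, S and R the
   coordinate rings of the ambient space and of the hyperplane. Since M_C is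
   killed by the variables, a nonzero class in degree m is a Koszul 1-cocycle
   modulo I: forms r_i of degree m + 1 with x_i r_j - x_j r_i in I, not of the
   form x_i s modulo I. For general l, which is a nonzerodivisor modulo I, the
   restriction of sum_i a_i r_i (the component of r along l = sum_i a_i x_i) is a
   nonzero element of I_X of degree m + 1. Moreover, since l M_C = 0, the
   restriction M_C -> H^1_*(I_X) is injective, so the r_i restrict to a
   nontrivial Koszul 1-cocycle modulo I_X. Comparing the Koszul complex with the
   free resolution turns it into a nonzero class of degree m + n + 1 in
   Tor_n(R / I_X, k), so m + n + 1 is a shift of the last free module. *)

Require Import Defs.
From mathcomp Require Import all_boot all_order all_algebra.
From mathcomp Require Import zify ring.
From Stdlib Require Import Classical IndefiniteDescription.
Import Order.TTheory GRing.Theory Num.Theory.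
Local Open Scope ring_scope.

Set Implicit Arguments.
Unset Strict Implicit.
Unset Printing Implicit Defensive.

(** * The Koszul complex of the variables *)

(** How [r] arises: if [x_i c] is the coboundary of [b_i], then [x_j b_i - x_i b_j] is the same on
    every chart, hence a polynomial, and it lies in [I]. These polynomials form a Koszul 2-cocycle,
    exact over [S] because there are at least three variables; [r] is a primitive. Why restriction
    is injective: if [r] becomes trivial on the hyperplane, then after subtracting some [x_i s] it
    is [x_i l sigma] modulo [I], with [sigma] a section of O_C(m - 1). The Buchsbaum hypothesis,
    applied to the image of [sigma] in M_C, makes [l sigma] the class of a polynomial, so [r] was
    already trivial. Where [m + n + 1] comes from: each step up the resolution raises the Koszul
    degree and the internal degree by one. Starting from [r], of Koszul degree 1 and degree [m + 1],
    the last module is reached in Koszul degree [n + 1], the number of variables of [R], and in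
    degree [m + n + 1]. There the only obstruction is a constant term, which needs a generator of
    exactly that degree. *)

Section Koszul.

Context (k : fieldType) (N : nat).
Local Notation R := {mpoly k[N]}.

(* The Koszul cochain complex on the variables 'X_i, i in l, as an iterated
   mapping cone: a cochain is a function on bit masks A of l, with c A the
   coefficient of the wedge of the selected basis vectors. *)
Fixpoint kd (V : lmodType R) (l : seq 'I_N) (c : seq bool -> V) (A : seq bool)
    : V :=
  match l, A with
  | i :: l', b :: A' =>
      if b then 'X_i *: c (false :: A') - kd l' (fun B => c (true :: B)) A'
      else kd l' (fun B => c (false :: B)) A'
  | _, _ => 0
  end.

Lemma eq_kd (V : lmodType R) (l : seq 'I_N) (c c' : seq bool -> V) A :
  (forall B, size B = size l -> c B = c' B) -> size A = size l ->
  kd l c A = kd l c' A.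
Proof.
elim: l A c c' => [|i l IHl] [|b A] c c' //= eq_cc' [szA].
have IH b' : kd l (fun B => c (b' :: B)) A = kd l (fun B => c' (b' :: B)) A.
  by apply: IHl => // B szB; apply: eq_cc'; rewrite /= szB.
by rewrite !IH eq_cc' //= szA.
Qed.

Lemma eq_kd_pointwise (V : lmodType R) (l : seq 'I_N) (c c' : seq bool -> V) :
  c =1 c' -> kd l c =1 kd l c'.
Proof.
move=> eq_cc'; elim: l c c' eq_cc' => [|i l IHl] c c' eq_cc' [|b A] //=.
have IH b' : kd l (fun B => c (b' :: B)) A = kd l (fun B => c' (b' :: B)) A.
  by apply: IHl => B; apply: eq_cc'.
by rewrite !IH eq_cc'.
Qed.

Lemma kdB (V : lmodType R) (l : seq 'I_N) (c c' : seq bool -> V) A :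
  kd l (fun B => c B - c' B) A = kd l c A - kd l c' A.
Proof.
elim: l A c c' => [|i l IHl] [|b A] c c' //=; rewrite ?subr0 //.
case: b; last exact: IHl.
by rewrite (IHl A (fun B => c (true :: B))) scalerBr !opprD addrACA.
Qed.

Lemma kdD (V : lmodType R) (l : seq 'I_N) (c c' : seq bool -> V) A :
  kd l (fun B => c B + c' B) A = kd l c A + kd l c' A.
Proof.
elim: l A c c' => [|i l IHl] [|b A] c c' //=; rewrite ?addr0 //.
case: b; last exact: IHl.
by rewrite (IHl A (fun B => c (true :: B))) scalerDr opprD addrACA.
Qed.

Lemma kd0 (V : lmodType R) (l : seq 'I_N) A : kd l (fun=> 0 : V) A = 0.
Proof.
elim: l A => [|i l IHl] [|b A] //=.
by rewrite IHl scaler0 subr0 if_same.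
Qed.

Lemma kdZ (V : lmodType R) (l : seq 'I_N) (a : R) (c : seq bool -> V) A :
  kd l (fun B => a *: c B) A = a *: kd l c A.
Proof.
elim: l A c => [|i l IHl] [|b A] c //=; rewrite ?scaler0 //.
case: b; last exact: IHl.
by rewrite (IHl A (fun B => c (true :: B))) scalerBr !scalerA mulrC.
Qed.

Lemma kdK (V : lmodType R) (l : seq 'I_N) (c : seq bool -> V) A :
  size A = size l -> kd l (kd l c) A = 0.
Proof.
elim: l A c => [|i l IHl] [|b A] c //= [szA].
case: b; last exact: IHl.
rewrite (kdB l (fun B => 'X_i *: c (false :: B))) kdZ IHl //.
by rewrite subr0 subrr.
Qed.

Definition kdeg (V : lmodType R) (j : nat) (c : seq bool -> V) :=
  forall A, count id A != j -> c A = 0.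

Lemma kdeg_kd (V : lmodType R) (l : seq 'I_N) (c : seq bool -> V) j :
  kdeg j c -> kdeg j.+1 (kd l c).
Proof.
elim: l c j => [|i l IHl] c j cj [|b A] //= hA.
case: b hA => /= hA; last by apply: (IHl _ j) hA => B hB; apply: cj.
rewrite cj ?scaler0 ?sub0r //; case: j cj hA => [|j] cj hA.
  rewrite (@eq_kd_pointwise _ _ _ (fun=> 0)) ?kd0 ?oppr0 // => B.
  exact: cj.
by rewrite (IHl _ j) ?oppr0 // => B hB; apply: cj.
Qed.

(* [f] lies in the ideal generated by the 'X_i, i in l. *)
Definition vanish (l : seq 'I_N) (f : R) : Prop :=
  forall w : 'X_{1..N}, (forall i, i \in l -> w i = 0%N) -> f@_w = 0.

Lemma vanishB l f g : vanish l f -> vanish l g -> vanish l (f - g).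
Proof. by move=> hf hg w hw; rewrite mcoeffB hf // hg // subr0. Qed.

Lemma mcoeffXUM i (f : R) w :
  ('X_i * f)@_w = if w i == 0%N then 0 else f@_(w - U_(i))%MM.
Proof.
rewrite mulrC; case: eqP => [wi0|/eqP wi0].
  apply/eqP; rewrite mcoeff_eq0; apply/negP => /msuppM_le /allpairsP [[u v] /=].
  case=> _; rewrite msuppX inE => /eqP -> /(congr1 (fun w : 'X_{1..N} => w i)).
  by rewrite mnmDE mnm1E eqxx wi0 addn1.
have {1}-> : w = (U_(i) + (w - U_(i)))%MM by rewrite addmC submK // lep1mP.
exact: mcoeffMX.
Qed.

Lemma vanishXM l i f : i \in l -> vanish l ('X_i * f).
Proof. by move=> il w hw; rewrite mcoeffXUM hw // eqxx. Qed.

Lemma vanish_mulX l i f : i \notin l -> vanish l ('X_i * f) -> vanish l f.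
Proof.
move=> il hf w hw; have := hf (U_(i) + w)%MM.
rewrite mulrC mcoeffMX; apply => j jl.
rewrite mnmDE hw // mnm1E addn0.
by case: eqP => // ij; rewrite ij jl in il.
Qed.

Lemma mpoly_divX i (f : R) :
  exists q : R, forall w : 'X_{1..N}, w i != 0%N -> (f - 'X_i * q)@_w = 0.
Proof.
elim/mpolyind: f => [|c m f _ _ [q hq]].
  by exists 0 => w _; rewrite mulr0 subr0 mcoeff0.
exists (q + (if m i == 0%N then 0 else c *: 'X_[m - U_(i)])) => w wi.
have -> : c *: 'X_[m] + f - 'X_i * (q + (if m i == 0 then 0 else c *: 'X_[m - U_(i)])) =
  (f - 'X_i * q) + (c *: 'X_[m] - 'X_i * (if m i == 0 then 0 else c *: 'X_[m - U_(i)]))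
  by ring.
rewrite mcoeffD hq // add0r; case: eqP => [mi0|/eqP mi0].
  rewrite mulr0 subr0 mcoeffZ mcoeffX; case: eqP => [mw|]; last by rewrite mulr0.
  by rewrite -mw mi0 eqxx in wi.
rewrite -scalerAr -mpolyXD addmC submK ?lep1mP // subrr; exact: mcoeff0.
Qed.

Lemma vanish_divX l i f :
  vanish (i :: l) f -> exists q, vanish l (f - 'X_i * q).
Proof.
move=> hf; have [q hq] := mpoly_divX i f; exists q => w hw.
have [wi|wi] := eqVneq (w i) 0%N; last exact: hq.
rewrite mcoeffB mcoeffXUM wi eqxx subr0; apply: hf => j.
by rewrite inE => /predU1P [->|/hw].
Qed.

(** Necessity of the top condition in [kd_exact]: every term of this coefficient carries a variable
    of [l]. *)
Lemma vanish_kd_top l (c : seq bool -> R^o) :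
  vanish l (kd l c (nseq (size l) true)).
Proof.
elim: l c => [|i l IHl] c /=; first by move=> w _; exact: mcoeff0.
apply: vanishB; first by apply: vanishXM; rewrite mem_head.
by move=> w hw; apply: IHl => j jl; apply: hw; rewrite inE jl orbT.
Qed.

Lemma kd_top0 (V : lmodType R) l (v : V) A :
  kd l (fun B => if all id B then v else 0) A = 0.
Proof.
elim: l A => [|j l IHl] [|[] A] //=; last exact: kd0.
by rewrite IHl scaler0 subr0.
Qed.

(** The variables in [l] form a regular sequence, so the only cohomology is the quotient by the
    ideal (l), in top degree. Along the mapping cone a cocycle is a pair [(a, b)] with [a] closed
    and ['X_i *: a = kd l b]. *)
Lemma kd_exact l (c : seq bool -> R^o) : uniq l ->
  (forall A, size A = size l -> kd l c A = 0) ->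
  vanish l (c (nseq (size l) true)) ->
  exists c', forall A, size A = size l -> c A = kd l c' A.
Proof.
elim: l c => [|i l IHl] c /=.
  move=> _ _ hc; exists (fun=> 0) => - [|//] _ /=.
  by apply/mpolyP => w; rewrite mcoeff0; apply: hc.
case/andP=> il ul dc0 ctop.
pose a B := c (false :: B); pose b B := c (true :: B).
have da A : size A = size l -> kd l a A = 0.
  by move=> sA; apply: (dc0 (false :: A)); rewrite /= sA.
have db A : size A = size l -> 'X_i *: a A = kd l b A.
  by move=> sA; apply/eqP; rewrite -subr_eq0 (dc0 (true :: A)) //= sA.
(* ['X_i] times the top coefficient of [a] is that of a coboundary, so it lies in (l), and ['X_i] is
   a nonzerodivisor modulo (l). *)
have [|w hw] := IHl a ul da.
  apply: (@vanish_mulX _ i) => //.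
  rewrite [_ * _]db ?size_nseq //; exact: vanish_kd_top.
have [|q hq] := @vanish_divX l i (b (nseq (size l) true) - 'X_i * w (nseq (size l) true)).
  by apply: vanishB => //; apply: vanishXM; rewrite mem_head.
(* The primitive [w] of [a] may be changed by the closed top cochain [t]; this moves the top
   coefficient of [b - 'X_i *: w] from the ideal (i :: l) into (l). *)
pose t B : R^o := if all id B then q else 0.
have dt A : kd l t A = 0 by exact: kd_top0.
pose e B := b B - 'X_i *: (w B + t B).
have [||w' hw'] := IHl e ul.
- move=> A sA; rewrite kdB (kdZ l 'X_i) kdD dt addr0 -hw // -db //.
  exact: subrr.
- have -> : e (nseq (size l) true) =
     b (nseq (size l) true) - 'X_i * w (nseq (size l) true) - 'X_i * q.
    by rewrite /e /t all_nseq orbT /=; rewrite /GRing.scale /=; ring.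
  exact: hq.
exists (fun B => if B is b :: B then if b then - w' B else w B + t B else 0).
case=> [|[] A] //= [sA]; last by rewrite kdD dt addr0 -hw.
rewrite (@eq_kd_pointwise _ _ _ (fun B => 0 - w' B)); last by move=> B; rewrite sub0r.
by rewrite kdB kd0 sub0r opprK -hw' // addrC subrK.
Qed.

Lemma vanish_enum f : f@_0%MM = 0 -> vanish (enum 'I_N) f.
Proof.
move=> f0 w hw; suff -> : w = 0%MM by [].
by apply/mnmP => i; rewrite mnm0E hw // mem_enum.
Qed.

Lemma kd_coord p (l : seq 'I_N) (c : seq bool -> 'rV[R]_p) q A :
  kd l c A 0 q = kd l (fun B => c B 0 q : R^o) A.
Proof.
elim: l A c => [|i l IHl] [|b A] c //=; rewrite ?mxE //.
by case: b; rewrite ?mxE IHl.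
Qed.

Lemma kd_mulmx p p' (D : 'M[R]_(p, p')) (l : seq 'I_N) (c : seq bool -> 'rV[R]_p) A :
  kd l (fun B => c B *m D) A = kd l c A *m D.
Proof.
elim: l A c => [|i l IHl] [|b A] c //=; rewrite ?mul0mx //.
case: b; last exact: (IHl A (fun B => c (false :: B))).
by rewrite (IHl A (fun B => c (true :: B))) mulmxBl scalemxAl.
Qed.

(** For the full list of variables (l) is the irrelevant ideal, so the top condition only concerns
    constant terms. *)
Lemma kd_exact_row p (c : seq bool -> 'rV[R]_p) :
  (forall A, size A = N -> kd (enum 'I_N) c A = 0) ->
  (forall q, (c (nseq N true) 0 q)@_0%MM = 0) ->
  exists c', forall A, size A = N -> c A = kd (enum 'I_N) c' A.
Proof.
move=> dc ctop; set l := enum 'I_N.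
have szl : size l = N by rewrite size_enum_ord.
have /fin_all_exists [c' hc'] q : exists c' : seq bool -> R^o,
    forall A, size A = size l -> c A 0 q = kd l c' A.
  apply: (kd_exact (c := fun A => c A 0 q)); first exact: enum_uniq.
    by move=> A; rewrite szl => sA; rewrite -kd_coord dc // mxE.
  by rewrite szl; apply: vanish_enum.
exists (fun A => \row_q c' q A) => A sA; apply/rowP => q.
rewrite kd_coord hc' ?szl //.
by refine (@eq_kd_pointwise R^o l (c' q) _ _ A) => B; rewrite mxE.
Qed.

(** * Koszul cochains of degree at most two *)

Section LowDegree.

Context (V : lmodType R).
Implicit Types (l : seq 'I_N) (A : seq bool).

Definition kzero (v : V) A := if has id A then 0 else v.

Fixpoint kone l (r : 'I_N -> V) A :=
  match l, A with
  | i :: l', b :: A' => if b then kzero (r i) A' else kone l' r A'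
  | _, _ => 0
  end.

(** Only the values [t i j] with [i] before [j] in [l] are read, which is enough for an alternating
    [t]. *)
Fixpoint ktwo l (t : 'I_N -> 'I_N -> V) A :=
  match l, A with
  | i :: l', b :: A' => if b then kone l' (t i) A' else ktwo l' t A'
  | _, _ => 0
  end.

Lemma eq_kone l r r' A : r =1 r' -> kone l r A = kone l r' A.
Proof. by move=> rr'; elim: l A => [|i l IHl] [|[] A] //=; rewrite rr'. Qed.

Lemma eq_ktwo l t t' A : t =2 t' -> ktwo l t A = ktwo l t' A.
Proof.
move=> tt'; elim: l A => [|i l IHl] [|[] A] //=.
by apply: eq_kone => j; rewrite tt'.
Qed.

Lemma kone_ind (P : V -> Prop) l r A :
  P 0 -> (forall i, P (r i)) -> P (kone l r A).
Proof.
by move=> P0 Pr; elim: l A => [|i l IHl] [|[] A] //=; rewrite /kzero; case: ifP.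
Qed.

Lemma ktwo_ind (P : V -> Prop) l t A :
  P 0 -> (forall i j, P (t i j)) -> P (ktwo l t A).
Proof.
by move=> P0 Pt; elim: l A => [|i l IHl] [|[] A] //=; apply: kone_ind.
Qed.

Lemma kdeg_kone l r : kdeg 1 (kone l r).
Proof.
elim: l => [|i l IHl] [|[] A] //=; last exact: IHl.
by rewrite /kzero has_count; case: (count id A).
Qed.

Lemma kdeg_ktwo l t : kdeg 2 (ktwo l t).
Proof.
elim: l => [|i l IHl] [|[] A] //=; last exact: IHl.
exact: kdeg_kone.
Qed.

Lemma koneZ l a r A : a *: kone l r A = kone l (fun j => a *: r j) A.
Proof.
elim: l A => [|i l IHl] [|[] A] //=; rewrite ?scaler0 // /kzero.
by case: ifP; rewrite ?scaler0.
Qed.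

Lemma koneB l r r' A : kone l r A - kone l r' A = kone l (fun j => r j - r' j) A.
Proof.
elim: l A => [|i l IHl] [|[] A] //=; rewrite ?subr0 // /kzero.
by case: ifP; rewrite ?subr0.
Qed.

Lemma ktwoZ l a t A : a *: ktwo l t A = ktwo l (fun i j => a *: t i j) A.
Proof.
elim: l A => [|i l IHl] [|[] A] //=; rewrite ?scaler0 //.
exact: koneZ.
Qed.

Lemma kd_kzero l v A : size A = size l ->
  kd l (kzero v) A = kone l (fun j => 'X_j *: v) A.
Proof.
elim: l A => [|i l IHl] [|[] A] //= [sA]; last by rewrite -IHl.
rewrite (@eq_kd_pointwise _ _ _ (fun=> 0)) // kd0 subr0 /kzero /=.
by case: ifP; rewrite ?scaler0.
Qed.

Lemma kd_kone l r A : size A = size l ->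
  kd l (kone l r) A = ktwo l (fun i j => 'X_i *: r j - 'X_j *: r i) A.
Proof.
elim: l A => [|i l IHl] [|[] A] //= [sA]; last by rewrite -IHl.
by rewrite kd_kzero // koneZ koneB.
Qed.

Lemma kd_ktwo l t A : size A = size l ->
  (forall i j m, 'X_i *: t j m - 'X_j *: t i m + 'X_m *: t i j = 0) ->
  kd l (ktwo l t) A = 0.
Proof.
move=> sA tcyc; elim: l A sA => [|i l IHl] [|[] A] //= [sA]; last exact: IHl.
rewrite kd_kone // ktwoZ; apply/eqP; rewrite subr_eq0; apply/eqP.
apply: eq_ktwo => j m; apply/eqP; rewrite -subr_eq0 opprB addrA.
by rewrite addrAC; apply/eqP; exact: tcyc.
Qed.

Definition single l (i : 'I_N) := [seq j == i | j <- l].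

Lemma single_notin l i : i \notin l -> single l i = nseq (size l) false.
Proof.
elim: l => //= j l IHl; rewrite inE negb_or eq_sym => /andP [/negPf -> il].
by rewrite IHl.
Qed.

Lemma kzero_nseq v m : kzero v (nseq m false) = v.
Proof. by rewrite /kzero has_nseq andbF. Qed.

Lemma kone_single l r i : uniq l -> i \in l -> kone l r (single l i) = r i.
Proof.
elim: l => //= j l IHl /andP [jl ul]; rewrite inE eq_sym.
case: eqP => [ji _|_ /= il]; last exact: IHl.
by rewrite -ji single_notin // kzero_nseq.
Qed.

Lemma kd_nseq_false l (c : seq bool -> V) : kd l c (nseq (size l) false) = 0.
Proof. by elim: l c => //= i l IHl c. Qed.

Lemma kd_single l (c : seq bool -> V) i : uniq l -> i \in l ->
  kd l c (single l i) = 'X_i *: c (nseq (size l) false).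
Proof.
elim: l c => //= j l IHl c /andP [jl ul]; rewrite inE eq_sym.
case: eqP => [ji _|_ /= il].
  by rewrite -ji single_notin // kd_nseq_false subr0.
exact: IHl.
Qed.

(** The primitive gives the formula for pairs in list order; alternation extends it to all pairs. *)
Lemma ktwo_kdP l t (c : seq bool -> V) : uniq l ->
  (forall A, size A = size l -> ktwo l t A = kd l c A) ->
  (forall i, t i i = 0) -> (forall i j, t j i = - t i j) ->
  forall i j, i \in l -> j \in l ->
  t i j = 'X_i *: c (single l j) - 'X_j *: c (single l i).
Proof.
elim: l c => //= m l IHl c /andP [ml ul] hc tii tC.
have hm j : j \in l -> t m j = 'X_m *: c (single (m :: l) j) -
                               'X_j *: c (single (m :: l) m).
  move=> jl; have := hc (true :: single l j); rewrite /= size_map => /(_ erefl).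
  rewrite kone_single // (@kd_single l (fun B => c (true :: B))) // => ->.
  rewrite eqxx (single_notin ml).
  by case: (m =P j) => // mj; rewrite mj jl in ml.
move=> i j; rewrite !inE => /predU1P [->|il] /predU1P [->|jl].
- by rewrite subrr tii.
- exact: hm.
- by rewrite tC hm // opprB.
have mi : (m == i) = false by apply/eqP => mi; rewrite mi il in ml.
have mj : (m == j) = false by apply/eqP => mj; rewrite mj jl in ml.
rewrite mi mj; apply: (IHl (fun B => c (false :: B))) => // A sA.
by apply: (hc (false :: A)); rewrite /= sA.
Qed.

End LowDegree.

End Koszul.

(** * Homogeneous components *)

Section Homogeneous.

Context (k : fieldType) (N : nat).
Local Notation R := {mpoly k[N]}.
Implicit Types (z : int) (f g : R).

Lemma homogzP z f :
  homogz z f <-> forall w, (mdeg w)%:Z != z -> f@_w = 0.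
Proof.
split=> hf w; first by move=> /eqP wz; apply/eqP; rewrite mcoeff_eq0; apply/negP => /hf.
by rewrite mcoeff_msupp => fw; apply/eqP; apply: contraNT fw => /hf ->.
Qed.

Lemma homogz0 z : homogz z (0 : R).
Proof. by apply/homogzP => w _; exact: mcoeff0. Qed.

Lemma homogzD z f g : homogz z f -> homogz z g -> homogz z (f + g).
Proof.
by move=> /homogzP hf /homogzP hg; apply/homogzP => w hw; rewrite mcoeffD hf ?hg ?addr0.
Qed.

Lemma homogzN z f : homogz z f -> homogz z (- f).
Proof. by move=> /homogzP hf; apply/homogzP => w hw; rewrite mcoeffN hf ?oppr0. Qed.

Lemma homogzB z f g : homogz z f -> homogz z g -> homogz z (f - g).
Proof. by move=> hf hg; apply: homogzD => //; apply: homogzN. Qed.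

Lemma homogzZ z a f : homogz z f -> homogz z (a *: f).
Proof. by move=> /homogzP hf; apply/homogzP => w hw; rewrite mcoeffZ hf ?mulr0. Qed.

Lemma homogz_sum z (I : Type) (s : seq I) (P : pred I) (F : I -> R) :
  (forall i, P i -> homogz z (F i)) -> homogz z (\sum_(i <- s | P i) F i).
Proof. by move=> hF; apply: big_ind => //; [apply: homogz0|apply: homogzD]. Qed.

Lemma homogzX (w : 'X_{1..N}) : homogz (mdeg w)%:Z ('X_[w] : R).
Proof. by move=> v; rewrite msuppX inE => /eqP ->. Qed.

Lemma homogzXU i : homogz 1 ('X_i : R).
Proof. by have := @homogzX U_(i)%MM; rewrite mdeg1. Qed.

Lemma homogzM z z' f g : homogz z f -> homogz z' g -> homogz (z + z') (f * g).
Proof.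
move=> hf hg w /msuppM_le /allpairsP [[u v] /= [/hf <- /hg <- ->]].
by rewrite mdegD PoszD.
Qed.

Lemma homogz_exp z f e : homogz z f -> homogz (z * e%:Z) (f ^+ e).
Proof.
move=> hf; elim: e => [|e IHe]; last by rewrite exprS intS mulrDr mulr1; exact: homogzM.
by rewrite expr0 mulr0 -mpolyX0 => w; rewrite msuppX inE => /eqP ->; rewrite mdeg0.
Qed.

Lemma homogz_divXU z i e f : homogz (z + e%:Z) ('X_i ^+ e * f) -> homogz z f.
Proof.
move=> /homogzP hf; apply/homogzP => w hw; have := hf (U_(i) *+ e + w)%MM.
rewrite mpolyXn mulrC mcoeffMX; apply.
by rewrite mdegD mdegMn mdeg1 mul1n PoszD addrC (inj_eq (addIr _)).
Qed.

Lemma homogz_lt0 z f : z < 0 -> homogz z f -> f = 0.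
Proof.
move=> z0 /homogzP hf; apply/mpolyP => w; rewrite mcoeff0 hf //.
by apply: contraTneq z0 => <-.
Qed.

(** Integer degrees, because a degree minus a shift can be negative; the component is then 0, in
    accordance with [homogz]. *)
Definition hcomp z f : R := if z is Posz d then pihomog mdeg d f else 0.

Lemma hcompD z f g : hcomp z (f + g) = hcomp z f + hcomp z g.
Proof. by case: z => d /=; rewrite ?pihomogD ?addr0. Qed.

Lemma hcomp0 z : hcomp z 0 = 0.
Proof. by case: z => d //=; rewrite pihomog0. Qed.

Lemma hcompB z f g : hcomp z (f - g) = hcomp z f - hcomp z g.
Proof. by case: z => d /=; rewrite ?pihomogB ?subr0. Qed.

Lemma hcomp_sum z (I : Type) (s : seq I) (P : pred I) (F : I -> R) :
  hcomp z (\sum_(i <- s | P i) F i) = \sum_(i <- s | P i) hcomp z (F i).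
Proof. exact: (big_morph _ (hcompD z) (hcomp0 z)). Qed.

Lemma homogz_hcomp z f : homogz z (hcomp z f).
Proof.
case: z => d /=; last exact: homogz0.
by move=> w hw; congr Posz; apply: (dhomogP _ _ _ (pihomogP mdeg d f)).
Qed.

Lemma hcomp_id z f : homogz z f -> hcomp z f = f.
Proof.
case: z => d hf /=; last by rewrite (homogz_lt0 _ hf).
by apply: pihomog_dE; apply/dhomogP => w /hf [].
Qed.

Lemma hcomp_neq z z' f : z != z' -> homogz z f -> hcomp z' f = 0.
Proof.
move=> zz' hf; case: z' zz' => d //= zd; rewrite pihomogE big_seq_cond big1 //.
by move=> w /andP [/hf hw /eqP wd]; rewrite -hw wd eqxx in zd.
Qed.

Lemma hcompM z z' f g : homogz z f -> hcomp (z + z') (f * g) = f * hcomp z' g.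
Proof.
move=> hf; elim/mpolyind: g => [|c w g _ _ IHg]; first by rewrite !(mulr0, hcomp0).
rewrite mulrDr !hcompD IHg mulrDr; congr (_ + _).
have hw : homogz (mdeg w)%:Z (c *: 'X_[w]) by apply/homogzZ/homogzX.
have [<-|wz'] := eqVneq (mdeg w)%:Z z'; first by rewrite !hcomp_id //; apply: homogzM.
rewrite (hcomp_neq wz' hw) mulr0; apply: hcomp_neq (homogzM hf hw).
by rewrite (inj_eq (addrI _)).
Qed.

Lemma homog_ideal_hcomp (J : R -> Prop) z f : homog_ideal J -> J f -> J (hcomp z f).
Proof. by move=> [[J0 _ _] Jh] Jf; case: z => d /=; [apply: Jh|]. Qed.

Lemma homogz_kd z (l : seq 'I_N) (c : seq bool -> R^o) A :
  (forall B, homogz z (c B)) -> homogz (z + 1) (kd l c A).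
Proof.
elim: l A c => [|i l IHl] [|b A] c hc /=; try exact: homogz0.
case: b; last exact: IHl.
apply: homogzB; last exact: IHl.
by rewrite addrC; apply: homogzM => //; apply: homogzXU.
Qed.

(** Taking components commutes with a homogeneous matrix, so any lift can be replaced by one in the
    right degrees. *)
Lemma homogz_mulmx_lift (p q : nat) (sh : 'I_p -> int) (sh' : 'I_q -> int) z
    (D : 'M[R]_(p, q)) (v : 'rV_p) (y : 'rV_q) :
  (forall i j, homogz (sh i - sh' j) (D i j)) ->
  (forall j, homogz (z - sh' j) (y 0 j)) -> y = v *m D ->
  y = (\row_i hcomp (z - sh i) (v 0 i)) *m D.
Proof.
move=> hD hy yE; apply/rowP => j; rewrite -(hcomp_id (hy j)) yE !mxE hcomp_sum.
apply: eq_bigr => i _; rewrite mxE mulrC [RHS]mulrC.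
have -> : z - sh' j = (sh i - sh' j) + (z - sh i) by ring.
exact: hcompM.
Qed.

End Homogeneous.

(** * Koszul cocycles and free resolutions *)

Section Resolution.

Context (k : fieldType) (n : nat).
Local Notation N := n.+1.
Local Notation R := {mpoly k[N]}.
Local Notation vars := (enum 'I_N).

Lemma count_le_vars (A : seq bool) : size A = N -> (count id A <= N)%N.
Proof. by move=> <-; exact: count_size. Qed.

(** A zigzag in the double complex of Koszul cochains with values in the resolution, by induction on
    the distance [j] to the last module. There [u] has top Koszul degree [n + 1], so it is closed,
    and a constant term in coordinate [q] would force [z + n.-1] to be the [q]-th shift. *)
Lemma kd_splits (sh : nat -> seq int)
    (di : forall i, 'M[R]_(size (sh i.+1), size (sh i))) (z : int) :
  (forall i (p : 'I_(size (sh i.+1))) (q : 'I_(size (sh i))),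
     homogz ((sh i.+1)`_p - (sh i)`_q) (di i p q)) ->
  (forall i (u : 'rV_(size (sh i.+1))), u *m di i = 0 <-> exists v, u = v *m di i.+1) ->
  (forall i p q, (di i p q)@_0%MM = 0) ->
  z + n.-1%:Z \notin sh n.-1 ->
  forall j i, (i + j).+1 = n -> forall u : seq bool -> 'rV[R]_(size (sh i)),
  kdeg i.+2 u -> (forall A (q : 'I_(size (sh i))), homogz (z + i%:Z - (sh i)`_q) (u A 0 q)) ->
  (forall A, size A = N -> exists v, kd vars u A = v *m di i) ->
  exists (s : seq bool -> 'rV_(size (sh i))) (t : seq bool -> 'rV_(size (sh i.+1))),
    forall A, size A = N -> u A = kd vars s A + t A *m di i.
Proof.
move=> di_h di_ex di_min zsh; elim=> [|j IHj] i.
  rewrite addn0 => iN u u_deg u_h _.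
  have [|q|s hs] := @kd_exact_row _ _ _ u.
  - move=> A sA; apply: (kdeg_kd _ u_deg); apply: contra_eqN (count_le_vars sA) => /eqP ->.
    by rewrite -iN ltnn.
  - have /homogzP := u_h (nseq N true) q; apply.
    rewrite mdeg0 eq_sym subr_eq0; apply: contraNneq zsh.
    by rewrite -iN /= => ->; apply: mem_nth.
  exists s, (fun=> 0) => A sA; by rewrite hs // mul0mx addr0.
move=> iN u u_deg u_h u_im.
(* [v] is a homogeneous lift of [kd vars u] one step up the resolution. Since [kd] squares to zero,
   [kd vars v] is again a boundary and induction applies. *)
have /functional_choice [v hv] (A : seq bool) : exists v : 'rV[R]_(size (sh i.+1)),
    [/\ size A = N -> kd vars u A = v *m di i, count id A != i.+3 -> v = 0
      & forall q : 'I_(size (sh i.+1)), homogz (z + i.+1%:Z - (sh i.+1)`_q) (v 0 q)].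
  case: (boolP ((count id A == i.+3) && (size A == N))) => [/andP [/eqP cA /eqP sA]|hA].
    have [v0 v0E] := u_im A sA.
    exists (\row_(q < size (sh i.+1)) hcomp (z + i.+1%:Z - (sh i.+1)`_q) (v0 0 q)); split=> [_||q].
    - apply: (homogz_mulmx_lift (sh' := fun q : 'I_(size (sh i)) => (sh i)`_q)
        (sh := fun q : 'I_(size (sh i.+1)) => (sh i.+1)`_q)) => // q.
      rewrite kd_coord; have -> : z + i.+1%:Z - (sh i)`_q = z + i%:Z - (sh i)`_q + 1.
        by rewrite intS; ring.
      by apply: homogz_kd => B; apply: u_h.
    - by rewrite cA eqxx.
    - by rewrite mxE; apply: homogz_hcomp.
  exists 0; split=> // [sA|q]; last by rewrite mxE; apply: homogz0.
  rewrite sA eqxx andbT in hA.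
  by rewrite mul0mx (kdeg_kd _ u_deg).
have [||||s' [t' hs']] := IHj i.+1 _ v.
- by rewrite addSnnS.
- by move=> A; case: (hv A).
- by move=> A; case: (hv A).
- move=> A sA; apply/di_ex; rewrite -kd_mulmx.
  transitivity (kd vars (kd vars u) A); last by apply: kdK; rewrite size_enum_ord.
  apply: eq_kd; rewrite size_enum_ord // => B sB.
  by case: (hv B) => ->.
(* Subtracting the image of [s'] makes [u] closed. Its top coefficient has no constant term: [u] has
   degree [i + 2], below the top, and by minimality the entries of [di i] have none. *)
have [A sA|q|s hs] := @kd_exact_row _ _ _ (fun A => u A - s' A *m di i).
- rewrite kdB; case: (hv A) => -> // _ _; rewrite hs' // mulmxDl -mulmxA.
  have -> : di i.+1 *m di i = 0.
    apply/row_matrixP => q; rewrite row0 rowE mulmxA; apply/di_ex.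
    by eexists; reflexivity.
  by rewrite mulmx0 addr0 kd_mulmx subrr.
- rewrite u_deg; last by rewrite count_nseq mul1n -iN; apply/eqP; lia.
  rewrite sub0r !mxE mcoeffN raddf_sum /= big1 ?oppr0 // => p _.
  by rewrite -[LHS]/(mcoeff 0%MM _) mulrC rmorphM /= di_min mul0r.
by exists s, s' => A sA; rewrite -hs // subrK.
Qed.

End Resolution.

(** Without that shift, [kd_splits] applies, from degree [z + 1], to a lift of the coboundary of [r]
    to the first free module. Its part [s] changes [r] only by elements of [J] and makes it closed
    over the polynomial ring, hence exact, against nontriviality. *)
Lemma koszul_class_shift (k : fieldType) (n : nat) (J : {mpoly k[n.+1]} -> Prop)
    (F : min_free_resolution J n) (z : int) (r : 'I_n.+1 -> {mpoly k[n.+1]}) :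
  (0 < n)%N -> (forall i, homogz z (r i)) ->
  (forall i j, J ('X_i * r j - 'X_j * r i)) ->
  ~ (exists s, forall i, J (r i - 'X_i * s)) ->
  z + n%:Z \in shifts F n.-1.
Proof.
case: F => sh au di sh0 au_h di_h Jau au_ex di_ex di_min /= n_gt0 r_h Jr r_nt.
apply: contraPT isT => zsh; case: r_nt.
pose N := n.+1;  set vars := enum 'I_N.
have szv : size vars = N by rewrite size_enum_ord.
pose c : seq bool -> {mpoly k[N]}^o := kone vars (r : 'I_N -> {mpoly k[N]}^o).
have J0 : J 0 by apply/Jau; exists 0; rewrite mul0mx mxE.
have kd_au (u : seq bool -> 'rV[{mpoly k[N]}]_(size (sh 0%N))) A :
    (kd vars u A *m au) 0 0 = kd vars (fun B => (u B *m au) 0 0 : {mpoly k[N]}^o) A.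
  by rewrite -kd_mulmx kd_coord.
have /functional_choice [v hv] (A : seq bool) : exists v : 'rV[{mpoly k[N]}]_(size (sh 0%N)),
    [/\ size A = N -> kd vars c A = (v *m au) 0 0, count id A != 2%N -> v = 0
      & forall q : 'I_(size (sh 0%N)), homogz (z + 1 - (sh 0%N)`_q) (v 0 q)].
  case: (boolP ((count id A == 2%N) && (size A == N))) => [/andP [/eqP cA /eqP sA]|hA].
    have /Jau [v0 v0E] : J (kd vars c A).
      rewrite kd_kone ?szv //; exact: ktwo_ind.
    exists (\row_(q < size (sh 0%N)) hcomp (z + 1 - (sh 0%N)`_q) (v0 0 q)); split=> [_||q].
    - rewrite -(homogz_mulmx_lift (sh' := fun=> 0)
        (sh := fun q : 'I_(size (sh 0%N)) => (sh 0%N)`_q) (y := (kd vars c A)%:M)).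
      + by rewrite mxE eqxx.
      + by move=> i j; rewrite subr0 ord1.
      + move=> j; rewrite ord1 mxE subr0 mulr1n; apply: homogz_kd => B.
        by apply: (@kone_ind _ _ {mpoly k[N]}^o (@homogz k N z)) => //; exact: homogz0.
      + by apply/rowP => j; rewrite !ord1 -v0E mxE eqxx.
    - by rewrite cA eqxx.
    - by rewrite mxE; apply: homogz_hcomp.
  exists 0; split=> // [sA|q]; last by rewrite mxE; apply: homogz0.
  rewrite sA eqxx andbT in hA.
  by rewrite mul0mx mxE (kdeg_kd _ (kdeg_kone _ _)).
have [|||||s [t hst]] := @kd_splits k n sh di (z + 1) di_h di_ex di_min _ n.-1 0%N _ v.
- have -> : z + 1 + n.-1%:Z = z + n%:Z by rewrite -[in RHS](prednK n_gt0) intS addrA.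
  exact: zsh.
- by rewrite add0n prednK.
- by move=> A; case: (hv A).
- by move=> A q; rewrite addr0; case: (hv A).
- move=> A sA; apply/au_ex/rowP => i; rewrite ord1 [RHS]mxE kd_au.
  transitivity (kd vars (kd vars c) A); last first.
    by refine (@kdK k N {mpoly k[N]}^o vars c A _); rewrite szv.
  refine (@eq_kd k N {mpoly k[N]}^o vars _ _ A _ _); rewrite ?szv // => B sB.
  by case: (hv B) => ->.
have di_au : di 0%N *m au = 0.
  apply/row_matrixP => q; rewrite row0 rowE mulmxA; apply/au_ex.
  by eexists; reflexivity.
(* subtracting the top coefficient keeps a cycle and makes it exact *)
pose e A : {mpoly k[N]}^o := c A - (s A *m au) 0 0.
pose e' A : {mpoly k[N]}^o := e A - (if all id A then e (nseq N true) else 0).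
have [|||w hw] := @kd_exact _ _ vars e'.
- exact: enum_uniq.
- move=> A; rewrite szv => sA; rewrite kdB kd_top0 subr0 kdB -kd_au.
  case: (hv A) => -> // _ _; rewrite hst // mulmxDl -mulmxA di_au mulmx0 addr0.
  exact: subrr.
- move=> m _; rewrite /e' szv all_nseq orbT subrr; exact: mcoeff0.
exists (w (nseq (size vars) false)) => i.
have ui : uniq vars by exact: enum_uniq.
have mi : i \in vars by rewrite mem_enum.
have := hw (single vars i); rewrite size_map => /(_ erefl).
rewrite (@kd_single _ _ {mpoly k[N]}^o) // => eqw.
rewrite -['X_i * _]eqw /e' /e /c kone_single //.
(* As [n > 0] there are two distinct variables, so a singleton mask is not the full one and the top
   correction is absent. *)
rewrite ifN; last first.
  apply/negP; rewrite all_map => /allP hall.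
  have /eqP i0 := hall ord0 (mem_enum _ _); have /eqP im := hall ord_max (mem_enum _ _).
  by have /(congr1 val) /= := etrans i0 (esym im); move: n_gt0; case: (n).
by rewrite subr0 opprB addrC subrK; apply/Jau; exists (s (single vars i)).
Qed.

(** * Chains of ideals and saturation *)

Lemma nat_min (P : nat -> Prop) :
  (exists m, P m) -> exists m, P m /\ forall p, P p -> (m <= p)%N.
Proof.
case=> m; have [b] := ubnP m; elim: b m => // b IHb m mb Pm.
have [[p [Pp pm]]|hm] := classic (exists p, P p /\ (p < m)%N).
  by apply: IHb Pp; apply: leq_trans pm _.
by exists m; split=> // p Pp; rewrite leqNgt; apply/negP => pm; apply: hm; exists p.
Qed.

(** Each chosen index attains the minimum of [f] over a tail. *)
Lemma nat_nondecreasing_subseq (f : nat -> nat) : exists phi : nat -> nat,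
  (forall i j, i < j -> phi i < phi j)%N /\
  (forall i j, i < j -> f (phi i) <= f (phi j))%N.
Proof.
have /functional_choice [p hp] m : exists p, (m <= p)%N /\ forall q, (m <= q)%N -> (f p <= f q)%N.
  have [|v [[p [mp <-]] hv]] := @nat_min (fun v => exists q, (m <= q)%N /\ f q = v).
    by exists (f m), m.
  by exists p; split=> // q mq; apply: hv; exists q.
pose phi := fix phi i := if i is i'.+1 then p (phi i').+1 else p 0%N.
have phiS i : (phi i < phi i.+1)%N by case: (hp (phi i).+1).
have phi_lt i j : (i < j)%N -> (phi i < phi j)%N.
  by move=> ij; apply: (homo_ltn ltn_trans phiS ij).
exists phi; split=> // i j /phi_lt /ltnW ij; case: i ij => [|i] ij.
  by case: (hp 0%N) => _; apply.
by case: (hp (phi i).+1) => _; apply; apply: leq_trans ij => /=; case: (hp (phi i).+1).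
Qed.

(** Pass to a subsequence once per variable, making its exponent nondecreasing. *)
Lemma dickson N (s : nat -> 'X_{1..N}) : exists i j, (i < j)%N /\ (s i <= s j)%MM.
Proof.
suff [phi [phi_lt hphi]] : exists phi : nat -> nat,
    (forall i j, i < j -> phi i < phi j)%N /\
    forall x, x \in enum 'I_N -> forall i j, (i < j)%N -> (s (phi i) x <= s (phi j) x)%N.
  exists (phi 0%N), (phi 1%N); split; first exact: phi_lt.
  by apply/mnm_lepP => x; apply: hphi => //; rewrite mem_enum.
elim: (enum 'I_N) => [|y l [phi [phi_lt hphi]]]; first by exists id; split.
have [psi [psi_lt hpsi]] := nat_nondecreasing_subseq (fun i => s (phi i) y).
exists (phi \o psi); split=> [i j ij|x]; first by apply/phi_lt/psi_lt.
by rewrite inE => /predU1P [->|xl] i j ij; [apply: hpsi|apply: hphi xl _ _ (psi_lt _ _ ij)].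
Qed.

Section Ideals.

Context (k : fieldType) (N : nat).
Local Notation R := {mpoly k[N]}.
Implicit Types (J : R -> Prop) (f g : R).

Lemma idealB J f g : ideal_pred J -> J f -> J g -> J (f - g).
Proof. by move=> [_ JD JM] Jf Jg; apply: JD => //; rewrite -mulN1r; apply: JM. Qed.

Lemma idealZ J (a : k) f : ideal_pred J -> J f -> J (a *: f).
Proof. by move=> [_ _ JM] Jf; rewrite -mul_mpolyC; apply: JM. Qed.

Lemma idealMr J f g : ideal_pred J -> J f -> J (f * g).
Proof. by move=> [_ _ JM] Jf; rewrite mulrC; apply: JM. Qed.

Lemma ideal_sum J (I : Type) (s : seq I) (P : pred I) (F : I -> R) :
  ideal_pred J -> (forall i, P i -> J (F i)) -> J (\sum_(i <- s | P i) F i).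
Proof. by move=> [J0 JD _] hF; apply: big_ind. Qed.

Lemma mlead_reduce f g : f != 0 -> g != 0 -> (mlead g <= mlead f)%MM ->
  exists h, f - h * g = 0 \/ (mlead (f - h * g) < mlead f)%O.
Proof.
move=> f0 g0 gf; exists ((mleadc f / mleadc g) *: 'X_[mlead f - mlead g]).
set c := mleadc f / _; set h := c *: _.
have c0 : c != 0 by rewrite mulf_neq0 ?invr_eq0 ?mleadc_eq0.
have mh : mlead (h * g) = mlead f.
  rewrite mleadM // ?mleadZ // ?mleadXm ?submK //.
  by rewrite scaler_eq0 (negPf c0) -msize_poly_eq0 msizeX.
have hgf : (h * g)@_(mlead f) = mleadc f.
  have := mcoeffMX g (mlead f - mlead g)%MM (mlead g).
  by rewrite submK // mulrC -scalerAl mcoeffZ => ->; rewrite divfK // mleadc_eq0.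
have [->|d0] := eqVneq (f - h * g) 0; [by left|right].
rewrite lt_neqAle; apply/andP; split; last first.
  by apply: le_trans (mleadB_le _ _) _; rewrite mh joinxx.
apply: contraNneq d0 => dE; rewrite -mleadc_eq0 dE mcoeffB hgf subrr //.
Qed.

(* Instead of finite generation: in a strictly increasing chain, elements of
   minimal leading monomial among those of [J i.+1] outside [J i] would have
   leading monomials contradicting Dickson's lemma. *)
Lemma ideal_chain_stationary (J : nat -> R -> Prop) :
  (forall i, ideal_pred (J i)) -> (forall i f, J i f -> J i.+1 f) ->
  exists i, forall f, J i.+1 f -> J i f.
Proof.
move=> Jid Jinc; apply: NNPP => Jstrict.
have J_mono i j f : (i <= j)%N -> J i f -> J j f.
  by move=> /subnK <-; elim: (j - i)%N => // e IHe /IHe /Jinc.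
have /functional_choice [f hf] i : exists f, [/\ J i.+1 f, ~ J i f &
    forall g, J i.+1 g -> ~ J i g -> ~ (mlead g < mlead f)%O].
  have [f [Jf nJf]] : exists f, J i.+1 f /\ ~ J i f.
    apply: NNPP => hi; apply: Jstrict; exists i => f Jf.
    by apply: NNPP => nJf; apply: hi; exists f.
  have [m mE] : exists m, mlead f = m by exists (mlead f).
  elim/(@ltmwf N): m f mE Jf nJf => m IHm f mE Jf nJf.
  have [[g [Jg nJg gf]]|hmin] := classic (exists g, [/\ J i.+1 g, ~ J i g & (mlead g < mlead f)%O]).
    by apply: (IHm (mlead g)) Jg nJg; rewrite -?mE.
  by exists f; split=> // g Jg nJg gf; apply: hmin; exists g.
have f0 i : f i != 0.
  by case: (hf i) (Jid i) => _ nJ _ [J0 _ _]; apply/eqP => fi0; rewrite fi0 in nJ.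
have [i [j [ij fij]]] := dickson (fun i => mlead (f i)).
have [h hh] := mlead_reduce (f0 j) (f0 i) fij.
have Jjfi : J j (h * f i).
  by case: (Jid j) => _ _; apply; case: (hf i) => Ji _ _; apply: J_mono Ji.
case: (hf j) => Jj nJj minj.
have nJd : ~ J j (f j - h * f i).
  by move=> Jd; apply: nJj; rewrite -[f j](subrK (h * f i)); case: (Jid j) => _ JD _; apply: JD.
case: hh => [d0|]; first by apply: nJd; rewrite d0; case: (Jid j).
by apply: minj => //; apply: idealB => //; apply: Jinc.
Qed.

(** By dependent choice, a counterexample would start a strictly increasing chain of
    counterexamples. *)
Lemma noetherian_ind (P : (R -> Prop) -> Prop) :
  (forall J, ideal_pred J ->
     (forall J', ideal_pred J' -> ideal_proper J J' -> P J') -> P J) ->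
  forall J, ideal_pred J -> P J.
Proof.
move=> IH J Jid; apply: NNPP => nPJ.
pose T := {J : R -> Prop | ideal_pred J /\ ~ P J}.
have /functional_choice [nxt hnxt] (x : T) : exists y : T, ideal_proper (sval x) (sval y).
  case: x => I [Iid nPI] /=; apply: NNPP => hI; apply: nPI; apply: IH => // I' I'id II'.
  by apply: NNPP => nPI'; apply: hI; exists (exist _ I' (conj I'id nPI')).
pose ch i := iter i nxt (exist _ J (conj Jid nPJ) : T).
have [|i f|i hi] := @ideal_chain_stationary (fun i => sval (ch i)).
- by move=> i; case: (svalP (ch i)).
- by case: (hnxt (ch i)) => h _; apply: h.
- by case: (hnxt (ch i)) => _ [f [/hi ? ?]].
Qed.

Lemma ideal_exprD J f g e e' : ideal_pred J ->
  J (f ^+ e) -> J (g ^+ e') -> J ((f + g) ^+ (e + e')).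
Proof.
move=> Jid Jf Jg; rewrite exprDn; apply: ideal_sum => // i _.
rewrite -mulr_natr; apply: idealMr => //.
have [ie|ie] := leqP e' i.
  by rewrite -(subnK ie) exprD; have [_ _ JM] := Jid; do 2!apply: (JM).
have -> : (e + e' - i = e + (e' - i))%N by rewrite addnBA // ltnW.
by rewrite exprD -mulrA; apply: idealMr.
Qed.

Definition saturated_at J e f := forall w : 'X_{1..N}, mdeg w = e -> J ('X_[w] * f).

Lemma saturated_atW J e e' f : ideal_pred J -> (e <= e')%N ->
  saturated_at J e f -> saturated_at J e' f.
Proof.
move=> Jid /subnK <-; elim: (e' - e)%N => // d IHd hf w wd.
have [i wi] : exists i, w i != 0%N.
  apply/existsP; apply: contra_eqT wd => /existsPn hw.
  by rewrite mdegE big1 // => i _; apply/eqP; rewrite -[_ == _]negbK hw.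
have wE : (w - U_(i) + U_(i))%MM = w by rewrite submK // lep1mP.
rewrite -wE mpolyXD mulrAC; apply: idealMr => //; apply: IHd => //.
by move: wd; rewrite -{1}wE mdegD mdeg1 addn1 => -[].
Qed.

Lemma saturation_ideal J : ideal_pred J -> ideal_pred (saturation J).
Proof.
move=> Jid; have [J0 JD JM] := Jid; split.
- by exists 0%N => w _; rewrite mulr0.
- move=> f g [e he] [e' he']; exists (maxn e e') => w wE; rewrite mulrDr.
  by apply: JD; [apply: (saturated_atW Jid (leq_maxl e e') he) |
                 apply: (saturated_atW Jid (leq_maxr e e') he')].
- by move=> f g [e he]; exists e => w /he Jw; rewrite mulrCA; apply: JM.
Qed.

Lemma saturation_pow J e f : ideal_pred J ->
  (forall i : 'I_N, J ('X_i ^+ e * f)) -> saturation J f.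
Proof.
(* Pigeonhole: a monomial of degree above [N * e] has some exponent above [e]. *)
move=> Jid hf; exists (N * e).+1 => w wE.
have [i wi] : exists i, (e < w i)%N.
  apply/existsP; apply: contra_eqT wE => /existsPn hw.
  rewrite mdegE neq_ltn; apply/orP; left; rewrite ltnS.
  rewrite -[X in (_ <= X * _)%N]card_ord -sum_nat_const.
  by apply: leq_sum => i _; rewrite leqNgt hw.
have wi' : (U_(i) *+ e <= w)%MM.
  apply/mnm_lepP => j; rewrite mulmnE mnm1E; case: eqP => [<-|_] //.
  by rewrite mul1n ltnW.
rewrite -(submK wi') mpolyXD -mpolyXn -mulrA.
by case: Jid => _ _; apply.
Qed.

End Ideals.

(** * General linear forms *)

(** A matrix with rows in [W] and of maximal rank spans [W]; a column of its cokernel that does not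
    kill [u] is the functional. *)
Lemma separating_functional (k : fieldType) (N : nat) (W : 'rV[k]_N -> Prop) (u : 'rV[k]_N) :
  W 0 -> (forall v w, W v -> W w -> W (v + w)) -> (forall a v, W v -> W (a *: v)) ->
  ~ W u -> exists phi : 'cV[k]_N,
    (u *m phi) 0 0 != 0 /\ forall w, W w -> (w *m phi) 0 0 = 0.
Proof.
move=> W0 WD WZ nWu.
have Wmul (p : nat) (A : 'M[k]_(p, N)) (x : 'rV_p) : (forall i, W (row i A)) -> W (x *m A).
  move=> WA; rewrite mulmx_sum_row; apply: big_ind => // i _; exact: WZ.
have [|d [[A WA rA] dmin]] := @nat_min (fun d => exists2 A : 'M[k]_N,
    forall i, W (row i A) & d = (N - \rank A)%N).
  by exists (N - 0)%N, 0 => [i|]; rewrite ?row0 ?mxrank0.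
have WsubA w : W w -> (w <= A)%MS.
  move=> Ww; have WB i : W (row i (A + w)%MS).
    have /sub_addsmxP [[x y] /= ->] := row_sub i (A + w)%MS.
    apply: WD; apply: Wmul => // j.
    by have -> : row j w = w by apply/rowP => c; rewrite ord1 mxE.
  have := dmin _ (ex_intro2 _ _ (A + w)%MS WB erefl).
  have Aw : (A <= A + w)%MS := addsmxSl A w.
  rewrite rA => le_rank; have := mxrank_leqif_sup Aw; case=> leA.
  have := rank_leq_col (A + w)%MS; have := rank_leq_col A => rA1 rA2.
  have -> : \rank A == \rank (A + w)%MS by apply/eqP; lia.
  by move=> /esym /(submx_trans (addsmxSr A w)).
have nuA : ~~ (u <= A)%MS.
  by apply/negP => /submxP [x ux]; apply: nWu; rewrite ux; apply: Wmul.
move: nuA; rewrite submxE => /rV0Pn [c uc].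
exists (col c (cokermx A)); split=> [|w /WsubA].
  by rewrite colE mulmxA -colE mxE.
rewrite submxE => /eqP wA.
by rewrite colE mulmxA wA mul0mx mxE.
Qed.

Section GeneralPosition.

Context (k : fieldType) (N : nat).
Local Notation R := {mpoly k[N]}.

Definition linform (a : 'rV[k]_N) : R := \sum_i a 0 i *: 'X_i.

Lemma linformD a b : linform (a + b) = linform a + linform b.
Proof. by rewrite -big_split; apply: eq_bigr => i _; rewrite mxE scalerDl. Qed.

Lemma linformB a b : linform (a - b) = linform a - linform b.
Proof. by rewrite -sumrB; apply: eq_bigr => i _; rewrite !mxE scalerBl. Qed.

Lemma linformZ c a : linform (c *: a) = c *: linform a.
Proof. by rewrite scaler_sumr; apply: eq_bigr => i _; rewrite mxE scalerA. Qed.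

Lemma linform_delta i : linform (delta_mx 0 i) = 'X_i.
Proof.
rewrite /linform (bigD1 i) //= mxE !eqxx scale1r big1 ?addr0 // => j ji.
by rewrite mxE (negPf ji) andbF scale0r.
Qed.

Lemma homogz_linform a : homogz 1 (linform a).
Proof. by apply: homogz_sum => i _; apply/homogzZ/homogzXU. Qed.

Lemma linform_meval (a b : 'rV[k]_N) : (linform a).@[fun i => b 0 i] = (b *m a^T) 0 0.
Proof.
rewrite /linform raddf_sum mxE; apply: eq_bigr => i _ /=.
by rewrite mevalZ mevalXU mxE mulrC.
Qed.

(* Noetherian induction mimicking the primary decomposition: a non-primary
   ideal J is the intersection of J + (g ^+ e) and J : g ^+ e; for a primary
   ideal whose radical misses a variable, the linear forms in the radical lie in
   a hyperplane. *)
Lemma general_linform_nzd (J : R -> Prop) : ideal_pred J ->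
  general_hyperplane (fun a => forall f, J (linform a * f) -> saturation J f).
Proof.
move: J; apply: noetherian_ind => J Jid IH; have [J0 JD JM] := Jid.
have [prim|] := classic (forall f g, J (f * g) -> J f \/ exists e, J (g ^+ e)).
  have [Xrad|] := classic (forall i : 'I_N, exists e, J ('X_i ^+ e)).
    (* The radical contains every variable, so the saturation is the whole ring and every [a]
       works. *)
    exists 1, 0%N; split=> [||a _ _ f _]; first exact: oner_neq0.
      by rewrite -mpolyX0 -(@mdeg0 N); exact: homogzX.
    have [e he] := fin_all_exists Xrad.
    apply: (@saturation_pow _ _ _ (\max_i e i)) => // i.
    rewrite -(subnK (leq_bigmax i)) exprD -mulrA.
    by apply: (JM); apply: idealMr.
  move=> /not_all_ex_not [j nj].
  have [||c v||phi [phij hphi]] := @separating_functional k N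
    (fun a => exists e, J (linform a ^+ e)) (delta_mx 0 j).
  - by exists 1%N; rewrite expr1 /linform big1 // => i _; rewrite mxE scale0r.
  - move=> v w [e he] [e' he']; exists (e + e')%N; rewrite linformD.
    exact: ideal_exprD.
  - by move=> [e he]; exists e; rewrite linformZ exprZn; apply: idealZ.
  - by rewrite linform_delta.
  exists (linform phi^T), 1%N; split=> [||a _ ga f Jaf].
  - apply: contraNneq phij => phi0.
    by rewrite -[phi]trmxK -linform_meval phi0 meval0.
  - exact: homogz_linform.
  rewrite mulrC in Jaf; case: (prim _ _ Jaf) => [Jf|/hphi a0].
    by exists 0%N => w _; apply: JM.
  by move: ga; rewrite linform_meval trmxK a0 eqxx.
move=> /not_all_ex_not [f0] /not_all_ex_not [g] nprim.
have {nprim} [Jfg nJf nJg] : [/\ J (f0 * g), ~ J f0 & forall e, ~ J (g ^+ e)].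
  split.
  - by apply: NNPP => h; apply: nprim => /h.
  - by move=> h; apply: nprim => _; left.
  - by move=> e h; apply: nprim => _; right; exists e.
have [||i hi] := @ideal_chain_stationary _ _ (fun i f => J (g ^+ i.+1 * f)).
- move=> i; split=> [|f f' hf hf'|f f' hf']; first by rewrite mulr0.
    by rewrite mulrDr; apply: JD.
  by rewrite mulrCA; apply: JM.
- by move=> i f hf; rewrite exprS -mulrA; apply: JM.
have {hi} [e e0 hi] : exists2 e, (0 < e)%N &
    forall f, J (g ^+ (e + e) * f) -> J (g ^+ e * f).
  exists i.+1 => // f; elim: {1}i.+1 => // d IHd hd; apply: IHd.
  rewrite addnC exprD -mulrA; apply: hi; rewrite mulrA -exprD.
  by have -> : (i.+2 + d = d.+1 + i.+1)%N by lia.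
pose J1 f := exists2 y, J y & exists a, f = y + a * g ^+ e.
pose J2 f := J (g ^+ e * f).
have J1id : ideal_pred J1.
  split=> [|f f' [y Jy [a ->]] [y' Jy' [a' ->]]|f f' [y Jy [a ->]]].
  - by exists 0 => //; exists 0; rewrite mul0r addr0.
  - by exists (y + y'); [apply: JD|exists (a + a'); ring].
  - by exists (f * y); [apply: JM|exists (f * a); ring].
have J2id : ideal_pred J2.
  split=> [|f f' hf hf'|f f' hf']; rewrite /J2; first by rewrite mulr0.
    by rewrite mulrDr; apply: JD.
  by rewrite mulrCA; apply: JM.
have sub1 f : J f -> J1 f by exists f => //; exists 0; rewrite mul0r addr0.
have sub2 f : J f -> J2 f by apply: JM.
(* For [y + a * g ^+ e] in [J2], [a * g ^+ (e + e)] lies in [J], hence already [a * g ^+ e] does, by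
   the choice of [e]. *)
have J12 f : J1 f -> J2 f -> J f.
  move=> [y Jy [a ->]]; rewrite /J2 mulrDr => hf; apply: JD => //.
  rewrite mulrC; apply: hi; rewrite exprD -mulrA.
  have := idealB Jid hf (JM (g ^+ e) _ Jy).
  by rewrite addrC addKr [_ * a]mulrC.
have [|g1 [d1 [g1n g1h hg1]]] := IH J1 J1id.
  split=> //; exists (g ^+ e); split=> //; exists 0 => //.
  by exists 1; rewrite add0r mul1r.
have [|g2 [d2 [g2n g2h hg2]]] := IH J2 J2id.
  split=> //; exists f0; split=> //; rewrite /J2 -(prednK e0) exprSr -mulrA [g * _]mulrC.
  exact: JM.
exists (g1 * g2), (d1 + d2)%N; split=> [||a a0]; first by rewrite mulf_neq0.
  by rewrite PoszD; apply: homogzM.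
rewrite mevalM mulf_eq0 negb_or => /andP [/(hg1 a a0) h1 /(hg2 a a0) h2] f Jf.
have [c1 hc1] := h1 f (sub1 _ Jf); have [c2 hc2] := h2 f (sub2 _ Jf).
exists (maxn c1 c2) => w wc.
by apply: J12; [apply: (saturated_atW J1id (leq_maxl c1 c2) hc1) |
                apply: (saturated_atW J2id (leq_maxr c1 c2) hc2)].
Qed.

End GeneralPosition.

(** * Cech classes killed by the variables *)

(* Over an abstract field, since [ring] and [field] are too slow on
   {fraction {mpoly k[N]}}. *)
Section FieldIdentities.

Context (F : fieldType).
Implicit Types (x y b c h r s : F).

Lemma cocycleB b b' b'' : (b'' - b') - (b'' - b) + (b' - b) = 0.
Proof. by ring. Qed.

Lemma subr_div x y h h' : x != 0 -> y != 0 ->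
  h' / y - h / x = (x * h' - y * h) / (x * y).
Proof. by move=> x0 y0; field; rewrite ?x0 ?y0. Qed.

(** Up to the factor [x * y * x' * y'] the sides are [c * h' / x' - b'] and [c * h / x - b], equal
    by hypothesis. *)
Lemma glue_identity x x' y y' c h h' b b' : x != 0 -> x' != 0 ->
  c * (h' / x' - h / x) = b' - b ->
  (x * y) * (c * h' * y' - b' * y' * x') = (x' * y') * (c * h * y - b * y * x).
Proof.
move=> x0 x'0 hb; have -> : b' = b + c * (h' / x' - h / x) by rewrite hb addrC subrK.
by field; rewrite ?x0 ?x'0.
Qed.

Lemma cross_identity x x' c b1 b2 b1' b2' :
  x * c = b2 - b1 -> x' * c = b2' - b1' -> x' * b1 - x * b1' = x' * b2 - x * b2'.
Proof.
move=> h h'; apply/eqP; rewrite -subr_eq0; apply/eqP.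
transitivity (x * (b2' - b1') - x' * (b2 - b1)); first by ring.
by rewrite -h -h'; ring.
Qed.

Lemma scaled_cross x x' y b b' : x' * (b * y) - x * (b' * y) = y * (x' * b - x * b').
Proof. by ring. Qed.

Lemma koszul_identity x1 x2 x3 b1 b2 b3 :
  x1 * (x3 * b2 - x2 * b3) - x2 * (x3 * b1 - x1 * b3) + x3 * (x2 * b1 - x1 * b2) = 0.
Proof. by ring. Qed.

Lemma section_identity x y b r s : x != 0 -> y != 0 ->
  s - (r - b) / x = (b * y - y * (r - x * s)) / (x * y).
Proof. by move=> x0 y0; field; rewrite ?x0 ?y0. Qed.

Lemma cross_swap x x' b b' r r' :
  x' * r - x * r' = x' * b - x * b' -> x * (r' - b') = x' * (r - b).
Proof.
move=> h; apply/eqP; rewrite -subr_eq0; apply/eqP.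
transitivity ((x' * b - x * b') - (x' * r - x * r')); first by ring.
by rewrite h subrr.
Qed.

Lemma coboundary_identity x b b' r s : x != 0 ->
  b' - b = x * ((s - (r - b') / x) - (s - (r - b) / x)).
Proof. by move=> x0; field. Qed.

End FieldIdentities.

Section Cech.

Context (k : fieldType) (N : nat) (C : closed_subscheme k N).
Local Notation R := {mpoly k[N]}.
Local Notation "x %:F" := (@FracField.tofrac {mpoly k[N]} x).

Lemma subscheme_homog : homog_ideal C.
Proof. by case: C. Qed.

Lemma subscheme_idealP : ideal_pred C.
Proof. by case: subscheme_homog. Qed.

Lemma subscheme_saturated f : saturation C f -> C f.
Proof. by case: C f. Qed.

Lemma mpolyXU_neq0 i : 'X_i != 0 :> R.
Proof. by rewrite -msize_poly_eq0 msizeX. Qed.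

Lemma mpolyXU_exp_neq0 i e : 'X_i ^+ e != 0 :> R.
Proof. by rewrite expf_neq0 // mpolyXU_neq0. Qed.

Lemma mpolyXU_dvd i j e e' (f g : R) : i != j ->
  'X_j ^+ e' * f = 'X_i ^+ e * g -> exists q, f = 'X_i ^+ e * q.
Proof.
move=> ij; elim: e f => [|e IHe] f fg; first by exists f; rewrite expr0 mul1r.
have [|q hq] := @vanish_divX _ _ [::] i f.
  have : vanish [:: i] ('X_j ^+ e' * f).
    by rewrite fg exprS -mulrA; apply: vanishXM; rewrite mem_head.
  elim: (e') => [|d IHd]; first by rewrite expr0 mul1r.
  by rewrite exprS -mulrA => /vanish_mulX h; apply: IHd; apply: h; rewrite inE eq_sym.
have fE : f = 'X_i * q.
  by apply/eqP; rewrite -subr_eq0; apply/eqP/mpolyP => w; rewrite mcoeff0; apply: hq.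
have [|q' qE] := IHe q; last by exists q'; rewrite fE qE exprS mulrA.
apply: (mulfI (mpolyXU_neq0 i)).
by rewrite mulrCA -fE fg exprS mulrA.
Qed.

(** The fractions [g j / 'X_j ^+ e] all coincide; two coprime denominators leave only a polynomial.
    These are the global sections of a twist of the structure sheaf. *)
Lemma mpolyXU_glue e (g : 'I_N -> R) : (1 < N)%N ->
  (forall i j, 'X_i ^+ e * g j = 'X_j ^+ e * g i) ->
  exists t, forall j, g j = 'X_j ^+ e * t.
Proof.
move=> N1 hg; pose i0 := Ordinal (ltnW N1); pose i1 := Ordinal N1.
have [|t tE] := @mpolyXU_dvd i0 i1 e e (g i0) (g i1) isT; first exact: hg.
exists t => j; apply: (mulfI (mpolyXU_exp_neq0 i0 e)).
by rewrite hg tE; ring.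
Qed.

Lemma ideal_section_common (I : finType) (ix : I -> 'I_N) (m : int) b :
  (forall x, ideal_section C U_(ix x)%MM m (b x)) ->
  exists e (f : I -> R), forall x,
    [/\ C (f x), homogz (m + e%:Z) (f x) & b x * ('X_(ix x) ^+ e)%:F = (f x)%:F].
Proof.
move=> /fin_all_exists [e /fin_all_exists [f hf]]; exists (\max_x e x)%N.
exists (fun x => 'X_(ix x) ^+ (\max_x e x - e x)%N * f x) => x.
have [Cf fh ->] := hf x; rewrite mdeg1 muln1 in fh.
have ex : (e x <= \max_x e x)%N by exact: leq_bigmax.
split; first by case: subscheme_idealP => _ _; apply.
  have -> : m + (\max_x e x)%N%:Z = 1 * (\max_x e x - e x)%N%:Z + (m + (e x)%:Z).
    by rewrite -{1}(subnK ex) PoszD; ring.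
  by apply: homogzM fh; apply/homogz_exp/homogzXU.
rewrite -[in LHS](subnK ex) exprD !rmorphM /= mulrCA; congr (_ * _).
by rewrite divfK // tofrac_eq0 mpolyXU_exp_neq0.
Qed.

(** The connecting map from H^0(O_C(m)) to H^1(I_C(m)): the [h j / 'X_j ^+ e] are local lifts of a
    section of O_C(m). *)
Lemma cocycle_of_quotients (m : int) e (h : 'I_N -> R) :
  (forall j, homogz (m + e%:Z) (h j)) ->
  (forall i j, C ('X_i ^+ e * h j - 'X_j ^+ e * h i)) ->
  cocycle C m (fun i j => (h j)%:F / ('X_j ^+ e)%:F - (h i)%:F / ('X_i ^+ e)%:F).
Proof.
move=> hh hC; split=> [i j|i j l]; last exact: cocycleB.
exists e, ('X_i ^+ e * h j - 'X_j ^+ e * h i); split=> //.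
  have -> : m + (e * mdeg (U_(i) + U_(j))%MM)%N%:Z = 1 * e%:Z + (m + e%:Z).
    by rewrite mdegD !mdeg1 PoszM; ring.
  by apply: homogzB; apply: homogzM => //; apply/homogz_exp/homogzXU.
have Xi0 := mpolyXU_exp_neq0 i e; have Xj0 := mpolyXU_exp_neq0 j e.
rewrite mpolyXD exprMn rmorphB !rmorphM /=.
by rewrite subr_div ?tofrac_eq0.
Qed.

(** The section of O_C(m) given by the [h j / 'X_j ^+ e] has its image in the deficiency module
    killed by linear forms, so its product with [linform a] lifts to a polynomial [p]. The power
    ['X_j ^+ d] expresses equality on the chart only. *)
Lemma buchsbaum_linform (m : int) e (h : 'I_N -> R) (a : 'rV[k]_N) : (1 < N)%N ->
  arithmetically_Buchsbaum C ->
  (forall j, homogz (m + e%:Z) (h j)) ->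
  (forall i j, C ('X_i ^+ e * h j - 'X_j ^+ e * h i)) ->
  exists d p, forall j, C ('X_j ^+ d * (linform a * h j - 'X_j ^+ e * p)).
Proof.
move=> N1 hB hh hC; have Cid := subscheme_idealP; have [_ _ CM] := Cid.
suff /fin_all_exists [d /fin_all_exists [p hp]] (l : 'I_N) :
    exists d p, forall j, C ('X_j ^+ d * ('X_l * h j - 'X_j ^+ e * p)).
  exists (\max_l d l)%N, (\sum_l a 0 l *: p l) => j.
  rewrite /linform mulr_suml mulr_sumr -sumrB mulr_sumr; apply: ideal_sum => // l _.
  rewrite -scalerAl -scalerAr -scalerBr -scalerAr; apply: idealZ => //.
  by rewrite -(subnK (leq_bigmax l)) exprD -mulrA; apply: CM.
have [b [b_sec b_eq]] := hB l m _ (cocycle_of_quotients hh hC).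
have [d [f hf]] := ideal_section_common b_sec.
have Xn0 i e' : ('X_i ^+ e')%:F != 0 by rewrite tofrac_eq0 mpolyXU_exp_neq0.
(* The numerator, over ['X_j ^+ (e + d)], of ['X_l * h j / 'X_j ^+ e] minus the correction [b j]. *)
pose G j := 'X_l * h j * 'X_j ^+ d - f j * 'X_j ^+ e.
have GE j : (G j)%:F = ('X_l)%:F * (h j)%:F * ('X_j ^+ d)%:F -
                       b j * ('X_j ^+ d)%:F * ('X_j ^+ e)%:F.
  by case: (hf j) => _ _ ->; rewrite /G rmorphB !rmorphM.
have [|p hp] := @mpolyXU_glue (e + d) G N1.
  move=> i j; apply/eqP; rewrite -tofrac_eq; apply/eqP.
  rewrite !exprD [LHS]tofracM [RHS]tofracM !GE.
  rewrite (tofracM ('X_i ^+ e)) (tofracM ('X_j ^+ e)).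
  exact: glue_identity.
exists d, p => j; have := hp j => hpj.
have -> : 'X_j ^+ d * ('X_l * h j - 'X_j ^+ e * p) = f j * 'X_j ^+ e.
  by rewrite -[RHS](subKr ('X_l * h j * 'X_j ^+ d)) -/(G j) hpj exprD; ring.
by case: (hf j) => Cf _ _; apply: idealMr.
Qed.

Lemma buchsbaum_socle (m : int) : (2 < N)%N -> arithmetically_Buchsbaum C ->
  deficiency_neq0 C m ->
  exists r : 'I_N -> R, [/\ forall i, homogz (m + 1) (r i),
    forall i j, C ('X_i * r j - 'X_j * r i)
    & ~ exists s, forall i, C (r i - 'X_i * s)].
Proof.
move=> N2 hB [c [cc nc]]; have Cid := subscheme_idealP; have [_ CD CM] := Cid.
have Xn0 i e' : ('X_i ^+ e')%:F != 0 by rewrite tofrac_eq0 mpolyXU_exp_neq0.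
have Xn1 i : ('X_i)%:F != 0 by rewrite tofrac_eq0 mpolyXU_neq0.
have /fin_all_exists [b hb] l := hB l m c cc.
have [e [f hf]] := @ideal_section_common _ snd (m + 1) (fun x : 'I_N * 'I_N => b x.1 x.2)
  (fun x => (hb x.1).1 x.2).
pose T l l' j := ('X_l')%:F * b l j - ('X_l)%:F * b l' j.
have TE l l' i j : T l l' i = T l l' j.
  exact: (cross_identity ((hb l).2 i j) ((hb l').2 i j)).
pose g l l' j := 'X_l' * f (l, j) - 'X_l * f (l', j).
have gE l l' j : (g l l' j)%:F = ('X_j ^+ e)%:F * T l l' j.
  case: (hf (l, j)) (hf (l', j)) => _ _ /= fl [_ _ /= fl'].
  by rewrite /g rmorphB !rmorphM /= -fl -fl' scaled_cross.
have /fin_all_exists [tau htau] l : exists tau : 'I_N -> R,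
    forall l' j, g l l' j = 'X_j ^+ e * tau l'.
  apply: (@fin_all_exists _ _ (fun l' t => forall j, g l l' j = 'X_j ^+ e * t)) => l'.
  apply: mpolyXU_glue; first exact: ltnW.
  move=> i j; apply/eqP; rewrite -tofrac_eq !rmorphM /= !gE (TE l l' i j).
  by rewrite mulrCA.
have tauT l l' j : (tau l l')%:F = T l l' j.
  by apply: (mulfI (Xn0 j e)); rewrite -gE htau rmorphM.
have i0 : 'I_N by apply: Ordinal (ltnW (ltnW N2)).
have tau_h l l' : homogz (m + 1 + 1) (tau l l').
  apply: (@homogz_divXU _ _ _ i0 e); rewrite -htau.
  have -> : m + 1 + 1 + e%:Z = 1 + (m + 1 + e%:Z) by ring.
  case: (hf (l, i0)) (hf (l', i0)) => _ h1 _ [_ h2 _].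
  by apply: homogzB; apply: homogzM => //; apply: homogzXU.
have tauC l l' : C (tau l l').
  apply: subscheme_saturated; apply: (@saturation_pow _ _ _ e) => // i.
  rewrite -htau; case: (hf (l, i)) (hf (l', i)) => h1 _ _ [h2 _ _].
  by apply: idealB => //; apply: CM.
have [|||w hw] := @kd_exact _ _ (enum 'I_N) (ktwo (enum 'I_N) (tau : _ -> _ -> R^o)).
- exact: enum_uniq.
- move=> A sA; apply: kd_ktwo => // i j l; apply/eqP; rewrite -tofrac_eq0; apply/eqP.
  rewrite !(rmorphD, rmorphN, rmorphM) /= !(tauT _ _ i0); exact: koszul_identity.
- rewrite kdeg_ktwo; first by move=> u _; exact: mcoeff0.
  rewrite count_nseq mul1n size_enum_ord; by move: N2; case: (N) => [|[|[|]]].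
(* The sign makes [r] satisfy the same cross relations as the [b l], so that [(r l - b l j) / 'X_l]
   does not depend on [l]. *)
pose r i := - hcomp (m + 1) (w (single (enum 'I_N) i)).
have tau_r i j : tau i j = 'X_j * r i - 'X_i * r j.
  have tii l : tau l l = 0.
    by apply/eqP; rewrite -tofrac_eq0 (tauT _ _ i0) /T subrr.
  have tC l l' : tau l' l = - tau l l'.
    by apply/eqP; rewrite -tofrac_eq rmorphN /= !(tauT _ _ i0) /T opprB.
  have tauE : tau i j = 'X_i * w (single (enum 'I_N) j) - 'X_j * w (single (enum 'I_N) i).
    exact: (@ktwo_kdP _ _ R^o _ _ _ (enum_uniq _) hw tii tC i j (mem_enum _ _) (mem_enum _ _)).
  rewrite -[LHS](hcomp_id (tau_h i j)) tauE hcompB (_ : m + 1 + 1 = 1 + (m + 1)); last by ring.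
  by rewrite !(hcompM _ _ (@homogzXU k N _)) /r !mulrN opprK addrC.
exists r; split=> [i|i j|[s hs]].
- by apply/homogzN/homogz_hcomp.
- by rewrite -tau_r.
have r_h i : homogz (m + 1) (r i) by apply/homogzN/homogz_hcomp.
apply: nc; pose s' := hcomp m s.
have hs' i : C (r i - 'X_i * s').
  have -> : r i - 'X_i * s' = hcomp (m + 1) (r i - 'X_i * s).
    rewrite hcompB (hcomp_id (r_h i)); congr (_ - _).
    by rewrite [m + 1]addrC (hcompM _ _ (@homogzXU k N _)).
  exact: (homog_ideal_hcomp _ subscheme_homog).
(* On chart [j] the choice [l = j] keeps only powers of ['X_j] in the denominator, and the numerator
   is in [C] because [r j - 'X_j * s'] is. *)
exists (fun j => s'%:F - ((r j)%:F - b j j) / ('X_j)%:F); split=> [i|i j].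
  exists e.+1, (f (i, i) - 'X_i ^+ e * (r i - 'X_i * s')).
  have [Cf fh fE] := hf (i, i).
  rewrite mdeg1 muln1; have eE : m + e.+1%:Z = m + 1 + e%:Z by rewrite intS addrA.
  split; first by apply: idealB => //; apply: CM.
    rewrite eE; apply: homogzB => //.
    have -> : m + 1 + e%:Z = 1 * e%:Z + (m + 1) by ring.
    apply: homogzM; first by apply/homogz_exp/homogzXU.
    apply: homogzB => //; rewrite addrC; apply: homogzM; first exact: homogzXU.
    exact: homogz_hcomp.
  rewrite exprS !(rmorphB, rmorphM) /= -fE /=.
  exact: section_identity.
have qE l n : ('X_l)%:F * ((r n)%:F - b n n) = ('X_n)%:F * ((r l)%:F - b l n).
  by apply: cross_swap; rewrite -[RHS](tauT l n n) tau_r rmorphB !rmorphM.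
apply: (mulfI (Xn1 i)); rewrite (hb i).2.
have Ej : ((r j)%:F - b j j) / ('X_j)%:F = ((r i)%:F - b i j) / ('X_i)%:F.
  by apply/eqP; rewrite eqr_div // mulrC qE mulrC.
by rewrite Ej; apply: coboundary_identity.
Qed.

End Cech.

(** * Restriction to a hyperplane *)

Lemma mpoly_gen_ind (k : fieldType) (N : nat) (P : {mpoly k[N]} -> Prop) :
  (forall c, P c%:MP) -> (forall i, P 'X_i) ->
  (forall f g, P f -> P g -> P (f + g)) -> (forall f g, P f -> P g -> P (f * g)) ->
  forall f, P f.
Proof.
move=> PC PX PD PM; elim/mpolyind => [|c m f _ _ Pf]; first exact: PC 0.
apply: PD => //; rewrite -mul_mpolyC; apply: (PM) => //; rewrite mpolyXE_id.
have P1 : P 1 by exact: PC 1.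
by apply: (big_ind _ P1 PM) => i _; elim: (m i) => [|e IHe] //; rewrite exprS; apply: (PM).
Qed.

Section LinearSubstitution.

Context (k : fieldType).

(** [restrict] for matrices of any shape, so that it can be composed with a section of the
    parametrization. *)
Definition lin_subst (p q : nat) (A : 'M[k]_(p, q)) (f : {mpoly k[p]}) : {mpoly k[q]} :=
  f \mPo [tuple \sum_(j < q) A i j *: 'X_j | i < p].

Context (p q : nat) (A : 'M[k]_(p, q)).

Lemma lin_substD f g : lin_subst A (f + g) = lin_subst A f + lin_subst A g.
Proof. exact: comp_mpolyD. Qed.

Lemma lin_substB f g : lin_subst A (f - g) = lin_subst A f - lin_subst A g.
Proof. exact: comp_mpolyB. Qed.

Lemma lin_substM f g : lin_subst A (f * g) = lin_subst A f * lin_subst A g.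
Proof. exact: rmorphM. Qed.

Lemma lin_substZ c f : lin_subst A (c *: f) = c *: lin_subst A f.
Proof. exact: comp_mpolyZ. Qed.

Lemma lin_substC c : lin_subst A c%:MP = c%:MP.
Proof. exact: comp_mpolyC. Qed.

Lemma lin_subst_sum (I : finType) (F : I -> {mpoly k[p]}) :
  lin_subst A (\sum_i F i) = \sum_i lin_subst A (F i).
Proof. exact: raddf_sum. Qed.

Lemma lin_substXU i : lin_subst A 'X_i = linform (row i A).
Proof.
rewrite /lin_subst comp_mpolyXU -tnth_nth tnth_mktuple /linform.
by apply: eq_bigr => j _; rewrite mxE.
Qed.

Lemma lin_subst_linform c : lin_subst A (linform c) = linform (c *m A).
Proof.
rewrite /linform lin_subst_sum.
under eq_bigr => i _ do rewrite lin_substZ lin_substXU /linform scaler_sumr.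
rewrite exchange_big; apply: eq_bigr => j _; rewrite mxE scaler_suml.
by apply: eq_bigr => i _; rewrite mxE scalerA.
Qed.

Lemma homogz_lin_subst z f : homogz z f -> homogz z (lin_subst A f).
Proof.
move=> hf; rewrite [f]mpolyE /lin_subst raddf_sum /= big_seq.
apply: homogz_sum => w /hf <-; rewrite comp_mpolyZ; apply: homogzZ.
rewrite comp_mpolyX mdegE; elim/big_rec2: _ => [|i d y _ hy].
  by rewrite -mpolyX0 -(@mdeg0 q); exact: homogzX.
rewrite PoszD; apply: homogzM => //; rewrite -[X in homogz X]mul1r.
apply: homogz_exp; rewrite tnth_mktuple; apply: homogz_sum => j _.
by apply/homogzZ/homogzXU.
Qed.

End LinearSubstitution.

Lemma lin_subst_comp (k : fieldType) (p q s : nat) (A : 'M[k]_(p, q)) (A' : 'M[k]_(q, s)) f :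
  lin_subst A' (lin_subst A f) = lin_subst (A *m A') f.
Proof.
elim/mpoly_gen_ind: f => [c|i|f g IHf IHg|f g IHf IHg].
- by rewrite !lin_substC.
- by rewrite !lin_substXU lin_subst_linform row_mul.
- by rewrite !lin_substD IHf IHg.
- by rewrite !lin_substM IHf IHg.
Qed.

Lemma lin_subst1 (k : fieldType) (p : nat) (f : {mpoly k[p]}) : lin_subst 1%:M f = f.
Proof.
elim/mpoly_gen_ind: f => [c|i|f g IHf IHg|f g IHf IHg].
- by rewrite lin_substC.
- by rewrite lin_substXU row1 linform_delta.
- by rewrite lin_substD IHf IHg.
- by rewrite lin_substM IHf IHg.
Qed.

(** The substitution sends ['X_i] to ['X_i - u i 0 *: linform a], so it is the identity modulo
    [linform a]. *)
Lemma lin_subst_outer (k : fieldType) (p : nat) (u : 'cV[k]_p) (a : 'rV[k]_p) f :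
  exists h, f - lin_subst (1%:M - u *m a) f = linform a * h.
Proof.
elim/mpoly_gen_ind: f => [c|i|f g [h hf] [h' hg]|f g [h hf] [h' hg]].
- by exists 0; rewrite lin_substC subrr mulr0.
- exists (u i 0)%:MP; rewrite lin_substXU raddfB /= row1.
  rewrite linformB linform_delta subKr row_mul.
  have -> : row i u *m a = u i 0 *: a.
    by apply/rowP => j; rewrite !mxE big_ord1 mxE.
  by rewrite linformZ mulrC mul_mpolyC.
- by exists (h + h'); rewrite lin_substD mulrDr -hf -hg; ring.
- exists (f * h' + h * lin_subst (1%:M - u *m a) g).
  by rewrite lin_substM mulrDr mulrCA -hg mulrA -hf; ring.
Qed.

Section HyperplaneSection.

Context (k : fieldType) (N : nat) (C : closed_subscheme k N.+1).
Context (a : 'rV[k]_N.+1) (B : 'M[k]_(N.+1, N)).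
Context (a_neq0 : a != 0) (aB : parametrizes a B).
Context (C_nzd : forall f, C (linform a * f) -> C f).

Local Notation S := {mpoly k[N.+1]}.
Local Notation R := {mpoly k[N]}.
Local Notation rho := (lin_subst B).

Definition cone_section (g : R) := exists f, C f /\ g = restrict B f.
Local Notation J := cone_section.

(** With [B'] a left inverse, the rows of [1 - B *m B'] lie in the left kernel of [B], a line
    spanned by [a]. *)
Lemma parametrization_split : exists (B' : 'M[k]_(N, N.+1)) (u : 'cV[k]_N.+1),
  B' *m B = 1%:M /\ B *m B' = 1%:M - u *m a.
Proof.
have [rB aB0] := aB.
have /row_fullP [B' B'B] : row_full B by rewrite /row_full rB.
suff /submxP [u uE] : (1%:M - B *m B' <= a)%MS.
  by exists B', u; split=> //; rewrite -uE opprB addrC subrK.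
have sub_ker : (1%:M - B *m B' <= kermx B)%MS.
  by apply/sub_kermxP; rewrite mulmxBl mul1mx -mulmxA B'B mulmx1 subrr.
apply: submx_trans sub_ker _.
have a_ker : (a <= kermx B)%MS by apply/sub_kermxP.
case: (mxrank_leqif_sup a_ker) => _ <-.
by rewrite mxrank_ker rB rank_rV a_neq0 subSnn.
Qed.

Lemma rho_linform0 : rho (linform a) = 0.
Proof.
have [_ aB0] := aB; rewrite lin_subst_linform aB0 /linform big1 // => i _.
by rewrite mxE scale0r.
Qed.

Lemma rho_eq0 f : rho f = 0 -> exists h, f = linform a * h.
Proof.
have [B' [u [_ BB']]] := parametrization_split => f0.
have [h hE] := lin_subst_outer u a f; exists h.
rewrite -hE -BB' -lin_subst_comp f0.
by have := lin_substC B' 0; rewrite mpolyC0 => ->; rewrite subr0.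
Qed.

Lemma cone_section_ideal : ideal_pred J.
Proof.
have [B' [_ [B'B _]]] := parametrization_split.
have [C0 CD CM] := subscheme_idealP C; split.
- by exists 0; split=> //; rewrite /restrict comp_mpoly0.
- move=> _ _ [f [Cf ->]] [g [Cg ->]]; exists (f + g); split; first exact: CD.
  by rewrite -lin_substD.
move=> g _ [f [Cf ->]]; exists (lin_subst B' g * f); split; first exact: CM.
by rewrite -[RHS]/(rho _) lin_substM lin_subst_comp B'B lin_subst1.
Qed.

Lemma rho_cone_section f : C f -> J (rho f).
Proof. by move=> Cf; exists f. Qed.

Lemma saturated_at_homogz e y g : homogz e%:Z y -> saturated_at J e g -> J (y * g).
Proof.
move=> hy hg; have Jid := cone_section_ideal.
rewrite [y]mpolyE mulr_suml big_seq; apply: ideal_sum => // w /hy [we].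
by rewrite -scalerAl; apply: idealZ => //; apply: hg.
Qed.

Context (m : int) (r : 'I_N.+1 -> S).
Context (r_h : forall i, homogz (m + 1) (r i)).
Context (r_cocycle : forall i j, C ('X_i * r j - 'X_j * r i)).
Context (r_nontrivial : ~ exists s, forall i, C (r i - 'X_i * s)).

Let ra : S := \sum_i a 0 i *: r i.

Lemma cross_ra j : C ('X_j * ra - linform a * r j).
Proof.
rewrite /linform mulr_suml mulr_sumr -sumrB; apply: ideal_sum => [|i _].
  exact: subscheme_idealP.
rewrite -scalerAl -scalerAr -scalerBr; apply: idealZ => //.
exact: subscheme_idealP.
Qed.

(** Exponent 1 suffices: modulo [C], ['X_j * ra] equals [linform a * r j], which restricts to 0. *)
Lemma section_ra : section_ideal C B (rho ra).
Proof.
have [B' [_ [B'B _]]] := parametrization_split; have Jid := cone_section_ideal.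
exists 1%N => w /eqP /mdeg1P [j /eqP ->].
have -> : 'X_j = rho (linform (row j B')).
  by rewrite lin_subst_linform -row_mul B'B row1 linform_delta.
rewrite /linform lin_subst_sum mulr_suml; apply: (@ideal_sum _ _ J) => // i _.
rewrite lin_substZ -scalerAl; apply: (@idealZ _ _ J) => //.
rewrite -lin_substM -[_ * ra](subrK (linform a * r i)) lin_substD.
rewrite [rho (linform a * _)]lin_substM rho_linform0 mul0r addr0.
exact/rho_cone_section/cross_ra.
Qed.

(** If [ra] were [linform a * s], cancelling [linform a] in [cross_ra] would make [r] trivial
    through [s]. *)
Lemma section_initial : ideal_neq0 (section_ideal C B) (m + 1).
Proof.
exists (rho ra); split; first exact: section_ra.
  by apply: homogz_lin_subst; apply: homogz_sum => i _; apply: homogzZ.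
apply/eqP => /rho_eq0 [s raE]; apply: r_nontrivial; exists s => j.
apply: C_nzd.
have -> : linform a * (r j - 'X_j * s) = -1 * ('X_j * ra - linform a * r j).
  by rewrite raE; ring.
by case: (subscheme_idealP C) => _ _; apply; apply: cross_ra.
Qed.

Lemma section_koszul_class : (1 < N)%N -> arithmetically_Buchsbaum C ->
  exists r' : 'I_N -> R, [/\ forall i, homogz (m + 1) (r' i),
    forall i j, section_ideal C B ('X_i * r' j - 'X_j * r' i)
    & ~ exists s, forall i, section_ideal C B (r' i - 'X_i * s)].
Proof.
move=> N1 hB; have [B' [u [B'B BB']]] := parametrization_split.
have Jid := cone_section_ideal; have Cid := subscheme_idealP C.
have [_ CD CM] := Cid; have [_ JD JM] := Jid.
have satid : ideal_pred (section_ideal C B) := saturation_ideal Jid.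
have J_sat f : J f -> section_ideal C B f.
  by move=> Jf; exists 0%N => w _; apply: JM.
have XE j : 'X_j = rho (linform (row j B')).
  by rewrite lin_subst_linform -row_mul B'B row1 linform_delta.
(* [r] is transported by the same matrix [B'] that lifts the variables of the hyperplane. *)
pose r' j := rho (\sum_i B' j i *: r i).
exists r'; split=> [j|p q|[s' hs']].
- by apply: homogz_lin_subst; apply: homogz_sum => i _; apply: homogzZ.
- rewrite /r' !XE -!lin_substM -lin_substB; apply/J_sat/rho_cone_section.
  rewrite /linform !mulr_suml.
  under eq_bigr => i _ do rewrite mulr_sumr.
  under [X in _ - X]eq_bigr => i _ do rewrite mulr_sumr.
  rewrite [X in _ - X]exchange_big -sumrB; apply: ideal_sum => // i _.
  rewrite -sumrB; apply: ideal_sum => // i' _.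
  rewrite !mxE -!scalerAl -!scalerAr !scalerA [B' q i' * _]mulrC -scalerBr.
  exact: idealZ.
pose s := lin_subst B' s'.
have rho_s : rho s = s' by rewrite lin_subst_comp B'B lin_subst1.
(* The identity matrix is [B *m B' + u *m a]: the first part is controlled by [hs'], the second by
   [section_ra]. *)
have sat_r i : section_ideal C B (rho (r i - 'X_i * s)).
  have -> : rho (r i - 'X_i * s) =
      \sum_j B i j *: (r' j - 'X_j * s') + u i 0 *: rho ra.
    rewrite lin_substB lin_substM rho_s lin_substXU.
    under eq_bigr => j _ do rewrite scalerBr scalerAl.
    rewrite sumrB -mulr_suml addrAC; congr (_ - _ * _); last first.
      by rewrite /linform; apply: eq_bigr => j _; rewrite mxE.
    rewrite /r' -lin_substZ.
    under eq_bigr => j _ do rewrite -lin_substZ.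
    rewrite -lin_subst_sum -lin_substD; congr (rho _).
    under eq_bigr => j _ do rewrite scaler_sumr.
    rewrite exchange_big /= /ra scaler_sumr -big_split /=.
    have rE : r i = \sum_l (1%:M : 'M[k]_N.+1) i l *: r l.
      rewrite (bigD1 i) //= mxE eqxx scale1r big1 ?addr0 // => l li.
      by rewrite mxE eq_sym (negPf li) scale0r.
    rewrite {1}rE; apply: eq_bigr => l _.
    have -> : (1%:M : 'M[k]_N.+1) i l = (B *m B') i l + u i 0 * a 0 l.
      by rewrite BB' !mxE big_ord1 subrK.
    rewrite scalerDl scalerA mxE scaler_suml; congr (_ + _).
    by apply: eq_bigr => j _; rewrite scalerA.
  have [_ satD _] := satid; apply: satD; last exact: (idealZ _ satid section_ra).
  by apply: ideal_sum => // j _; apply: idealZ.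
have [e hsat] : exists e, forall i, saturated_at J e (rho (r i - 'X_i * s)).
  have /fin_all_exists [e he] := sat_r; exists (\max_i e i)%N => i.
  exact: (saturated_atW Jid (leq_bigmax i) (he i)).
pose t i := r i - 'X_i * hcomp m s.
have /fin_all_exists [h hh] i : exists h,
    homogz (m + e%:Z) h /\ C ('X_i ^+ e * t i - linform a * h).
  have [|f [Cf fE]] := @saturated_at_homogz e (rho ('X_i ^+ e)) _ _ (hsat i).
    apply: homogz_lin_subst; rewrite -[X in homogz X]mul1r.
    by apply: homogz_exp; apply: homogzXU.
  have [|h hE] := @rho_eq0 ('X_i ^+ e * (r i - 'X_i * s) - f).
    by rewrite lin_substB lin_substM fE subrr.
  exists (hcomp (m + e%:Z) h); split; first exact: homogz_hcomp.
  have -> : 'X_i ^+ e * t i - linform a * hcomp (m + e%:Z) h =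
            hcomp (e%:Z + (m + 1)) f.
    have Xe : homogz e%:Z ('X_i ^+ e : S).
      by rewrite -[X in homogz X]mul1r; apply: homogz_exp; apply: homogzXU.
    rewrite -(hcompM _ _ (@homogz_linform _ _ a)) -hE (_ : 1 + _ = e%:Z + (m + 1)); last by ring.
    rewrite hcompB (hcompM _ _ Xe) hcompB (hcomp_id (@r_h i)) (_ : m + 1 = 1 + m) 1?addrC //.
    rewrite (hcompM _ _ (@homogzXU k _ i)) /t; ring.
  exact: (homog_ideal_hcomp _ (subscheme_homog C)).
have tC i j : C ('X_i * t j - 'X_j * t i).
  have -> : 'X_i * t j - 'X_j * t i = 'X_i * r j - 'X_j * r i by rewrite /t; ring.
  exact: r_cocycle.
(* Modulo [C], [t j / 'X_j] is [linform a] times [h j / 'X_j ^+ e.+1]; these quotients form a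
   section of O_C(m - 1), whence the exponent [e.+1]. *)
have [|i j|d [p hp]] := @buchsbaum_linform _ _ C (m - 1) e.+1 h a (ltnW N1 : (1 < N.+1)%N) hB.
- move=> j; have -> : m - 1 + e.+1%:Z = m + e%:Z by rewrite intS addrA subrK.
  by case: (hh j).
- apply: C_nzd.
  have -> : linform a * ('X_i ^+ e.+1 * h j - 'X_j ^+ e.+1 * h i) =
    'X_i ^+ e * 'X_j ^+ e * ('X_i * t j - 'X_j * t i)
    - 'X_i ^+ e.+1 * ('X_j ^+ e * t j - linform a * h j)
    + 'X_j ^+ e.+1 * ('X_i ^+ e * t i - linform a * h i) by rewrite !exprS; ring.
  apply: CD; last by apply: CM; case: (hh i).
  by apply: idealB => //; apply: CM => //; case: (hh j).
have tp j : C ('X_j ^+ (d + e) * (t j - 'X_j * p)).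
  have -> : 'X_j ^+ (d + e) * (t j - 'X_j * p) =
    'X_j ^+ d * (linform a * h j - 'X_j ^+ e.+1 * p)
    + 'X_j ^+ d * ('X_j ^+ e * t j - linform a * h j) by rewrite exprD exprS; ring.
  by apply: CD => //; apply: CM; case: (hh j).
apply: r_nontrivial; exists (hcomp m s + p) => j.
have -> : r j - 'X_j * (hcomp m s + p) = t j - 'X_j * p by rewrite /t; ring.
(* [tp] only bounds the power of ['X_j] for index [j]; one more factor ['X_i] allows the cocycle
   relation to pass from [j] to [i]. *)
apply/(@subscheme_saturated _ _ C)/(@saturation_pow _ _ C (d + e).+1) => // i.
have -> : 'X_i ^+ (d + e).+1 * (t j - 'X_j * p) =
  'X_i ^+ (d + e) * ('X_i * t j - 'X_j * t i)
  + 'X_j * ('X_i ^+ (d + e) * (t i - 'X_i * p)) by rewrite exprS; ring.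
by apply: CD; apply: CM.
Qed.

End HyperplaneSection.

(** * Initial and final degrees *)

Lemma initial_degree_exists (supp : int -> Prop) (b : int) :
  (exists z, supp z) -> (forall z, supp z -> b <= z) -> exists a, initial_degree supp a.
Proof.
move=> [z0 sz0] hb; have [|e [se emin]] := @nat_min (fun e => supp (b + e%:Z)).
  have bz0 := hb _ sz0; exists `|z0 - b|%N.
  by have -> : b + `|z0 - b|%N%:Z = z0 by lia.
exists (b + e%:Z); split=> // z sz; have bz := hb _ sz.
have zE : b + `|z - b|%N%:Z = z by lia.
by have := emin `|z - b|%N; rewrite zE => /(_ sz); lia.
Qed.

Lemma final_degree_exists (supp : int -> Prop) (b : int) :
  (exists z, supp z) -> (forall z, supp z -> z <= b) -> exists a, final_degree supp a.
Proof.
move=> [z0 sz0] hb.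
have [||a [sa amin]] := @initial_degree_exists (fun z => supp (- z)) (- b).
- by exists (- z0); rewrite opprK.
- by move=> z /hb; rewrite lerNl.
by exists (- a); split=> // z sz; rewrite lerNr; apply: amin; rewrite opprK.
Qed.

Lemma sorted_ge_bounds (s : seq int) z : sorted >=%R s -> z \in s ->
  s`_(size s).-1 <= z <= s`_0.
Proof.
move=> s_sorted zs; have iz : (index z s < size s)%N by rewrite index_mem.
have ge_trans : transitive (>=%R : rel int) by move=> x y w; rewrite /= => xy yw; apply: le_trans yw xy.
have ge_refl : reflexive (>=%R : rel int) by move=> x; rewrite /=.
have mono := sorted_leq_nth ge_trans ge_refl 0 s_sorted.
rewrite -{1 2}(nth_index 0 zs); apply/andP; split; apply: mono; rewrite ?inE //.
- by case: (size s) iz.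
- by rewrite -ltnS prednK //; case: (size s) iz.
- by case: (size s) iz.
Qed.

Theorem proposition4p18 (k : closedFieldType) (n : nat) (hn : (0 < n)%N)
    (C : closed_subscheme k n.+2) (hC : is_curve C)
    (hB : arithmetically_Buchsbaum C) (hnCM : ~ arithmetically_CM C) :
  general_hyperplane (fun a : 'rV[k]_n.+2 =>
    forall B : 'M[k]_(n.+2, n.+1), parametrizes a B ->
    forall (F : min_free_resolution (section_ideal C B) n) (m d : seq int)
           (M : 'M[int]_(size m, size d)),
      m = shifts F n.-1 -> sorted >=%R m ->
      d = shifts F 0 -> sorted >=%R d ->
      M = lifting_matrix m d ->
      exists alphaM alphaplusM alphaX : int,
        [/\ initial_degree (deficiency_neq0 C) alphaM,
            final_degree (deficiency_neq0 C) alphaplusM,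
            initial_degree (ideal_neq0 (section_ideal C B)) alphaX,
            Num.max (m`_(size m).-1 - n%:Z - 1) (alphaX - 1) <= alphaM
          & alphaplusM <= m`_0 - n%:Z - 1]).
Proof.
(* All genericity is here: [g] depends on [C] alone and is fixed before [B] and the resolution. *)
have [g [e [g0 gh hg]]] := general_linform_nzd (subscheme_idealP C).
exists g, e; split=> // a a0 /(hg a a0) nzd B aB F m d M mE m_sorted _ _ _.
have C_nzd f : C (linform a * f) -> C f by move=> /nzd /subscheme_saturated.
have key z : deficiency_neq0 C z ->
    ideal_neq0 (section_ideal C B) (z + 1) /\ z + 1 + n%:Z \in m.
  move=> /(buchsbaum_socle (hn : (2 < n.+2)%N) hB) [r [r_h r_coc r_nt]].
  split; first exact: (section_initial a0 aB C_nzd r_h r_coc r_nt).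
  have [r' [r'_h r'_coc r'_nt]] :=
    section_koszul_class a0 aB C_nzd r_h r_coc r_nt (hn : (1 < n.+1)%N) hB.
  by rewrite mE; apply: koszul_class_shift r'_h r'_coc r'_nt.
have bounds z : deficiency_neq0 C z ->
    m`_(size m).-1 - n%:Z - 1 <= z <= m`_0 - n%:Z - 1.
  by move=> /key [_ /(sorted_ge_bounds m_sorted)]; lia.
have [z0 def_z0] : exists z, deficiency_neq0 C z.
  apply: NNPP => nz; apply: hnCM => z c cc; apply: NNPP => nc.
  by apply: nz; exists z, c.
have [||alphaX hX] := @initial_degree_exists (ideal_neq0 (section_ideal C B)) 0.
- by exists (z0 + 1); case: (key _ def_z0).
- move=> z [f [_ fh f0]]; rewrite leNgt; apply: contraNN f0 => z_lt0.
  by rewrite (homogz_lt0 z_lt0 fh).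
have lowM z : deficiency_neq0 C z -> alphaX - 1 <= z.
  by move=> /key [/(proj2 hX)]; lia.
have [||alphaM hM] := @initial_degree_exists (deficiency_neq0 C) (alphaX - 1) => //.
  by exists z0.
have [||alphaplusM hM'] := @final_degree_exists (deficiency_neq0 C) (m`_0 - n%:Z - 1).
- by exists z0.
- by move=> z /bounds /andP [].
exists alphaM, alphaplusM, alphaX; split=> //.
  by rewrite ge_max lowM ?andbT; [case/andP: (bounds _ hM.1)|exact: hM.1].
by case/andP: (bounds _ hM'.1).
Qed.
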